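(* Let $\mathbf{a}$ be a Turing degree and let $G$ be a finitely generated group whose word problem is of Turing degree at most $\mathbf{a}$. Let $m,n\in\mathbb{N}$ and let $A\in M_{m\times n}(\mathbb{Z}G)$. Then the $L^2$-Betti number $\dim_{\mathcal{R}G}\ker(R_A^{(2)})$ is $\mathbf{a}$-right-computable.
   Context: Turing degrees: for $f,g:\mathbb{N}\to\mathbb{N}$, $f\le_T g$ means that $f$ is computable by a Turing machine with oracle $g$; $f,g$ are Turing equivalent if $f\le_T g$ and $g\le_T f$; the Turing degree of $f$ is its equivalence class, and degrees are partially ordered by $\le_T$. The degree of a subset of a countable encoded set is that of its characteristic function; functions to $\mathbb{Q}$ and sets of words are treated via standard encodings. Word problem: for a finitely generated group $G$ with finite generating set $S$, let $S^*$ be the set of words in the elements of $S$ and their formal inverses. The word problem of $G$ is the set $\{w\in S^*\mid w=e \text{ in } G\}$; its Turing degree does not depend on the choice of $S$. A real number $r$ is $\mathbf{a}$-right-computable if there is a sequence $q:\mathbb{N}\to\mathbb{Q}$ of Turing degree at most $\mathbf{a}$ with $r=\lim_{n\to\infty}q_n$ and $q_n\ge r$ for all $n\in\mathbb{N}$. $\ell^2G$ is the Hilbert space of square-summable functions $G\to\mathbb{C}$. For $A\in M_{m\times n}(\mathbb{Z}G)$, $R_A^{(2)}:(\ell^2G)^m\to(\ell^2G)^n$ denotes the bounded operator given by right multiplication by $A$. For a closed $G$-invariant subspace $V\subset(\ell^2G)^m$ with orthogonal projection $P_V$, the von Neumann dimension is $\dim_{\mathcal{R}G}V=\sum_{i=1}^m\langle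 P_V(e_i),e_i\rangle$, where $e_i$ is the vector with $\delta_e\in\ell^2G$ in position $i$ and $0$ elsewhere. *)

(* Defs.v *)
From Stdlib Require Import Relation_Operators.
From mathcomp Require Import all_boot all_order all_algebra finmap complex.
From mathcomp Require Import all_classical all_reals all_analysis.

Set Implicit Arguments.
Unset Strict Implicit.
Unset Printing Implicit Defensive.

Import Order.TTheory GRing.Theory Num.Theory.
Import numFieldNormedType.Exports.

Local Open Scope classical_set_scope.
Local Open Scope ring_scope.
Local Open Scope complex_scope.

Inductive direction := Left | Stay | Right.

(* Finitely many two-way infinite tapes, each with its own head; one step
   writes a symbol on every tape and then moves every head.  [input_tape],
   [output_tape] and [query_tape] are allowed to coincide. *)
Record oracle_machine := OracleMachine {
  state : finType;
  symbol : finType;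
  tape_index : finType;
  blank : symbol;
  one : symbol;
  one_neq_blank : one != blank;
  start_state : state;
  query_state : state;
  answer_state : state;
  halt_state : state;
  input_tape : tape_index;
  output_tape : tape_index;
  query_tape : tape_index;
  transition : state -> (tape_index -> symbol) ->
               state * (tape_index -> symbol * direction)
}.

Section OracleMachine.
Variable M : oracle_machine.

(* Cells are numbered relative to the head, which always scans cell 0. *)
Definition tape := int -> symbol M.

Definition tape_update (t : tape) (ac : symbol M * direction) : tape :=
  let written := fun z : int => if z == 0 then ac.1 else t z in
  match ac.2 with
  | Left => fun z => written (z - 1)
  | Stay => written
  | Right => fun z => written (z + 1)
  end.

(* [x] ones starting at the head, on an otherwise blank tape. *)
Definition unary (x : nat) : tape := fun z =>
  if z is Posz i then (if (i < x)%N then one M else blank M) else blank M.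

Definition config : Type := (state M * (tape_index M -> tape))%type.

Definition init_config (x : nat) : config :=
  (start_state M, fun i => if i == input_tape M then unary x else unary 0).

(* A query replaces [unary x] by [unary (g x)] on the query tape in a single
   step.  There is no step out of [halt_state], and none out of [query_state]
   if the query tape is not of the form [unary x]. *)
Inductive step (g : nat -> nat) : config -> config -> Prop :=
| step_transition s (ts : tape_index M -> tape) :
    s != halt_state M -> s != query_state M ->
    step g (s, ts)
      ((transition s (fun i => ts i 0)).1,
       fun i => tape_update (ts i) ((transition s (fun i => ts i 0)).2 i))
| step_query (ts : tape_index M -> tape) (x : nat) :
    query_state M != halt_state M -> ts (query_tape M) = unary x ->
    step g (query_state M, ts)
      (answer_state M, fun i => if i == query_tape M then unary (g x) else ts i).

Definition computes_with_oracle (g f : nat -> nat) : Prop :=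
  forall x, exists c : config,
    [/\ clos_refl_trans config (step g) (init_config x) c,
        c.1 = halt_state M & c.2 (output_tape M) = unary (f x)].

End OracleMachine.

Definition turing_le (f g : nat -> nat) : Prop :=
  exists M : oracle_machine, computes_with_oracle M g f.

Definition turing_equiv (f g : nat -> nat) : Prop :=
  turing_le f g /\ turing_le g f.

Record turing_degree := TuringDegree {
  degree_class :> set (nat -> nat);
  degree_classP : exists g, degree_class = [set f | turing_equiv f g]
}.

Definition degree_at_most (f : nat -> nat) (a : turing_degree) : Prop :=
  exists2 g, degree_class a g & turing_le f g.

(* Countable types are encoded in [nat] by the library's [pickle]; the lemmas
   below spell out this encoding for words and for rationals.  Numbers that
   encode nothing are mapped to 0. *)
Definition encode_fun (T U : countType) (f : T -> U) : nat -> nat :=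
  fun n => if pickle_inv n is Some x then choice.pickle (f x) else 0%N.

Definition char_fun (T : countType) (A : set T) : T -> nat :=
  fun x => nat_of_bool `[< A x >].

Definition encode_set (T : countType) (A : set T) : nat -> nat :=
  encode_fun (char_fun A).

Lemma pickle_Posz (n : nat) :
  choice.pickle (Posz n) = CodeSeq.code [:: CodeSeq.code [:: n]; CodeSeq.code [::]].
Proof. by []. Qed.

Lemma pickle_Negz (n : nat) :
  choice.pickle (Negz n) = CodeSeq.code [:: CodeSeq.code [::]; CodeSeq.code [:: n]].
Proof. by []. Qed.

Lemma pickle_ratE (q : rat) :
  choice.pickle q = CodeSeq.code [:: choice.pickle (numq q); choice.pickle (denq q)].
Proof. by []. Qed.

(* [(i, false)] is the letter [S i] and [(i, true)] its formal inverse. *)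
Notation word k := (seq ('I_k * bool)).

Lemma pickle_wordE k (w : word k) :
  choice.pickle w = CodeSeq.code
    [seq CodeSeq.code [:: nat_of_ord l.1; nat_of_bool l.2] | l <- w].
Proof. by []. Qed.

Section WordProblem.
Variables (G : groupType) (k : nat) (S : 'I_k -> G).

Definition eval_word (w : word k) : G :=
  (\prod_(l <- w) (if l.2 then (S l.1)^-1 else S l.1))%g.

Definition generates : Prop := forall g : G, exists w, eval_word w = g.

Definition word_problem : set (word k) := [set w | eval_word w = 1%g].

End WordProblem.

Definition right_computable (R : realType) (a : turing_degree) (r : R) : Prop :=
  exists q : nat -> rat,
    [/\ degree_at_most (encode_fun q) a,
        ratr (q n) @[n --> \oo] --> r &
        forall n, r <= ratr (q n)].

(* The underlying additive group of the integral group ring; its product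
   enters only through [rmul]. *)
Definition group_ring (G : groupType) : Type := {fsfun G -> int with 0}.

Section L2.
Variables (R : realType) (G : groupType).

Definition square_summable (f : G -> R[i]) : Prop :=
  summable setT (fun g => (Normc.normc (f g) ^+ 2)%:E).

(* The elements of (l^2 G)^m are the vectors of [l2 m]. *)
Definition vect (m : nat) := 'I_m -> G -> R[i].

Definition l2 (m : nat) : set (vect m) :=
  [set x | forall i, square_summable (x i)].

(* Unconditional sums of absolutely summable families; [\esum] is for
   nonnegative terms only. *)
Definition real_sum (f : G -> R) : R :=
  fine (\esum_(g in setT) ((EFin \o f)^\+ g) -
        \esum_(g in setT) ((EFin \o f)^\- g))%E.

Definition complex_sum (f : G -> R[i]) : R[i] :=
  real_sum (fun g => complex.Re (f g)) +i* real_sum (fun g => complex.Im (f g)).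

Definition inner (m : nat) (x y : vect m) : R[i] :=
  \sum_(i < m) complex_sum (fun g => x i g * (y i g)^*).

Definition basis_vect (m : nat) (i : 'I_m) : vect m :=
  fun j g => ((j == i) && (g == 1%g))%:R.

(* The orthogonal projection of [x] on [V], which exists for every [x] in
   [l2 m] if [V] is a closed subspace of [l2 m]. *)
Definition orth_proj (m : nat) (V : set (vect m)) (x : vect m) : vect m :=
  xget (fun _ _ => 0)
    [set y | V y /\ forall z, V z -> inner (fun i g => x i g - y i g) z = 0].

(* To be used for closed [G]-invariant subspaces [V] of [l2 m]. *)
Definition vN_dim (m : nat) (V : set (vect m)) : R[i] :=
  \sum_(i < m) inner (orth_proj V (basis_vect i)) (basis_vect i).

(* (\sum_g f(g) g) * (\sum_h a(h) h) = \sum_g (\sum_h f(g h^-1) a(h)) g *)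
Definition rmul (f : G -> R[i]) (a : group_ring G) : G -> R[i] :=
  fun g => \sum_(h <- finsupp a) f (g * h^-1)%g * (a h)%:~R.

Definition rmul_mx (m n : nat) (A : 'M[group_ring G]_(m, n)) (x : vect m) :
    vect n :=
  fun j g => \sum_(i < m) rmul (x i) (A i j) g.

Definition ker_rmul_mx (m n : nat) (A : 'M[group_ring G]_(m, n)) :
    set (vect m) :=
  [set x | l2 x /\ forall j g, rmul_mx A x j g = 0].

End L2.

(* Main.v *)
Require Import Defs.
From Stdlib Require Import Relation_Operators Operators_Properties.
From mathcomp Require Import all_boot all_order all_algebra finmap complex zify ring lra.
From mathcomp Require Import all_classical all_reals all_analysis.

(** Let [L] be the operator of right multiplication by the matrix, [K] an integer
    that is at least the square of its norm, and [T = 1 - K^-1 L^* L].  This is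
    a self-adjoint contraction, and [|T u|^2 <= |u|^2 - K^-1 |L u|^2]
    ([dot_heat_le]).  For a basis vector [e] the numbers
    [<T^(2p) e, e> = |T^p e|^2] therefore decrease to a limit.  Since
    [|T^(2p) e - T^(2q) e|^2] is a combination of such numbers, the vectors
    [T^(2p) e] converge; the limit lies in the kernel by the displayed
    inequality ([heat_lim_ker]), and [e] minus the limit is orthogonal to the
    kernel because [T] is self-adjoint and fixes the kernel
    ([heat_lim_orth]).  The limit is thus the orthogonal projection of [e]
    ([orth_proj_ker]), and the dimension of the kernel is the limit of the
    decreasing traces of [T^(2p)] ([vN_dim_ker]).

    These traces are rational and computable from the word problem.  The entries
    of [K - L^* L] are sums of signed group elements, so that [K^(2p)] times
    the trace of [T^(2p)] is the number of closed walks of length [2p] with sign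
    plus, minus the number of those with sign minus ([count_walksE]).  There are
    finitely many walks, numbered by their digits, and whether a walk is closed
    is a question about a word.  After adding a small term that makes the
    fraction reduced, the code of the trace is a primitive recursive expression
    in the word problem ([encode_upper_bound]).

    That such an expression is computed by an oracle machine is shown through
    structured programs on tapes, which compile to machines
    ([prog_turing_le]).  Registers are tapes in unary, and the machine that
    reduces the word problem to the given oracle is run as a subroutine which
    erases its tapes afterwards, so that it can be called again
    ([exec_call]). *)

Set Implicit Arguments.
Unset Strict Implicit.
Unset Printing Implicit Defensive.

Import Order.TTheory GRing.Theory Num.Theory.
Import numFieldNormedType.Exports.

Local Open Scope ring_scope.

(** * While programs on finitely many tapes *)
Section TapePrograms.
Variables (I A : finType) (b o : A) (qt : I).
Hypothesis o_neq_b : o != b.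

Definition cells := int -> A.

Definition write_move (t : cells) (ad : A * direction) : cells :=
  let written := fun z : int => if z == 0 then ad.1 else t z in
  match ad.2 with
  | Left => fun z => written (z - 1)
  | Stay => written
  | Right => fun z => written (z + 1)
  end.

Definition ones (x : nat) : cells := fun z =>
  if z is Posz i then (if (i < x)%N then o else b) else b.

Definition scan (ts : I -> cells) : I -> A := fun i => ts i 0.

(** Testing a symbol takes a machine step of its own, in which nothing moves. *)
Definition idle (sc : I -> A) : I -> A * direction := fun i => (sc i, Stay).

Lemma write_idle (ts : I -> cells) :
  (fun i => write_move (ts i) (idle (scan ts) i)) = ts.
Proof.
by apply/funext => i; apply/funext => z; rewrite /write_move /idle /=; case: eqP => [->|].
Qed.

Inductive prog :=
| Act of (I -> A) -> I -> A * direction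
| Query
| Seq of prog & prog
| If of ((I -> A) -> bool) & prog & prog
| While of ((I -> A) -> bool) & prog.

Section Exec.
Variable g : nat -> nat.

Inductive exec : prog -> (I -> cells) -> (I -> cells) -> Prop :=
| exec_act f ts : exec (Act f) ts (fun i => write_move (ts i) (f (scan ts) i))
| exec_query ts x : ts qt = ones x ->
    exec Query ts (fun i => if i == qt then ones (g x) else ts i)
| exec_seq c d ts1 ts2 ts3 :
    exec c ts1 ts2 -> exec d ts2 ts3 -> exec (Seq c d) ts1 ts3
| exec_if (t : (I -> A) -> bool) c d ts1 ts2 :
    exec (if t (scan ts1) then c else d) ts1 ts2 -> exec (If t c d) ts1 ts2
| exec_while_stop (t : (I -> A) -> bool) c ts :
    ~~ t (scan ts) -> exec (While t c) ts ts
| exec_while_step (t : (I -> A) -> bool) c ts1 ts2 ts3 :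
    t (scan ts1) -> exec c ts1 ts2 -> exec (While t c) ts2 ts3 ->
    exec (While t c) ts1 ts3.

Lemma exec_while_iter (t : (I -> A) -> bool) c (n : nat) (s : nat -> I -> cells) :
  (forall k, (k < n)%N -> t (scan (s k))) -> ~~ t (scan (s n)) ->
  (forall k, (k < n)%N -> exec c (s k) (s k.+1)) ->
  exec (While t c) (s 0%N) (s n).
Proof.
elim: n s => [|n IHn] s tT tF cs; first exact: exec_while_stop.
apply: exec_while_step (tT 0%N _) (cs 0%N _) _ => //.
by apply: (IHn (fun k => s k.+1)) => // k kn; [apply: tT|apply: cs].
Qed.

End Exec.

(** The control states of a compiled program: one state for each elementary
    action, and one more for each test. *)
Fixpoint control (c : prog) : finType :=
  match c with
  | Act _ | Query => unit
  | Seq c d => (control c + control d)%type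
  | If _ c d => option (control c + control d)
  | While _ c => option (control c)
  end.

Fixpoint entry (c : prog) : control c :=
  match c with
  | Act _ | Query => tt
  | Seq c _ => inl (entry c)
  | If _ _ _ | While _ _ => None
  end.

(** [None] as the next state means that the program has ended, and [None] as
    the action means an oracle query. *)
Fixpoint next (c : prog) (sc : I -> A) :
    control c -> option (control c) * option (I -> A * direction) :=
  match c with
  | Act f => fun=> (None, Some (f sc))
  | Query => fun=> (None, None)
  | Seq c d => fun q =>
      match q with
      | inl p => let r := next sc p in
          (Some (if r.1 is Some p' then inl p' else inr (entry d)), r.2)
      | inr p => let r := next sc p in (omap inr r.1, r.2)
      end
  | If t c d => fun q =>
      match q with
      | None => (Some (Some (if t sc then inl (entry c) else inr (entry d))),
                 Some (idle sc))
      | Some (inl p) =>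
          let r := next sc p in (omap (fun p' => Some (inl p')) r.1, r.2)
      | Some (inr p) =>
          let r := next sc p in (omap (fun p' => Some (inr p')) r.1, r.2)
      end
  | While t c => fun q =>
      match q with
      | None => (if t sc then Some (Some (entry c)) else None, Some (idle sc))
      | Some p => let r := next sc p in (Some r.1, r.2)
      end
  end.

Section Runs.
Variable g : nat -> nat.

Inductive acts : option (I -> A * direction) -> (I -> cells) -> (I -> cells) -> Prop :=
| acts_move f ts : acts (Some f) ts (fun i => write_move (ts i) (f i))
| acts_query ts x : ts qt = ones x ->
    acts None ts (fun i => if i == qt then ones (g x) else ts i).

Inductive runs (c : prog) : option (control c) -> (I -> cells) -> (I -> cells) -> Prop :=
| runs_exit ts : runs None ts ts
| runs_step q ts1 ts2 ts3 :
    acts (next (scan ts1) q).2 ts1 ts2 -> runs (next (scan ts1) q).1 ts2 ts3 ->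
    runs (Some q) ts1 ts3.

Lemma acts_idle ts : acts (Some (idle (scan ts))) ts ts.
Proof. by rewrite -{3}[ts]write_idle; constructor. Qed.

(** The one property of [next] behind the compilation of all constructs: the
    states of a subprogram are embedded by [phi] into those of the whole, and
    the end of the subprogram is redirected to [out]. *)
Lemma runs_embed (c d : prog) (phi : control c -> control d) (out : option (control d)) :
  (forall sc q, next sc (phi q) =
     (if (next sc q).1 is Some p then Some (phi p) else out, (next sc q).2)) ->
  forall q ts1 ts2 ts3, runs q ts1 ts2 -> runs out ts2 ts3 ->
  runs (if q is Some p then Some (phi p) else out) ts1 ts3.
Proof.
move=> phiP q ts1 ts2 ts3 r; elim: r ts3 => // {}q {}ts1 ts1' {}ts2 a _ IH ts3 r.
by apply: (@runs_step _ (phi q) _ ts1'); rewrite phiP //=; apply: IH.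
Qed.

Lemma exec_runs c ts1 ts2 : exec g c ts1 ts2 -> runs (Some (entry c)) ts1 ts2.
Proof.
elim=> {c ts1 ts2} [f ts|ts x tsE|c d ts1 ts2 ts3 _ IH1 _ IH2|t c d ts1 ts2 _|t c ts tF
  |t c ts1 ts2 ts3 tT _ IH1 _ IH2].
- by apply: (@runs_step (Act f) tt); constructor.
- by apply: (@runs_step Query tt); constructor.
- have dIH := @runs_embed d (Seq c d) inr None _ _ _ _ _ IH2 (@runs_exit _ _).
  apply: (@runs_embed c (Seq c d) inl (Some (inr (entry d))) _ _ _ _ _ IH1).
    by move=> sc q /=; case: (next sc q) => -[].
  by apply: dIH => sc q /=; case: (next sc q) => -[].
- move=> IH; apply: (@runs_step (If t c d) None _ ts1); first exact: acts_idle.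
  move: IH => /=; case: (t _) => IH.
    apply: (@runs_embed c (If t c d) (fun p => Some (inl p)) None _ _ _ _ _ IH (@runs_exit _ _)).
    by move=> sc q /=; case: (next sc q) => -[].
  apply: (@runs_embed d (If t c d) (fun p => Some (inr p)) None _ _ _ _ _ IH (@runs_exit _ _)).
  by move=> sc q /=; case: (next sc q) => -[].
- apply: (@runs_step (While t c) None _ ts); first exact: acts_idle.
  by rewrite /= (negbTE tF); constructor.
- apply: (@runs_step (While t c) None _ ts1); first exact: acts_idle.
  rewrite /= tT.
  apply: (@runs_embed c (While t c) Some (Some None) _ _ _ _ _ IH1 IH2).
  by move=> sc q /=; case: (next sc q) => -[].
Qed.

End Runs.

Section Compile.
Variables (c : prog) (inp out : I).

(** The control state is kept on an additional tape.  A machine has a single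
    query state and a single answer state; with the control on a tape, that
    tape remembers where to resume after the answer, and a program may have
    several query sites.  On the other tapes the control component of a symbol
    always has the value [Some (entry c)], which makes the initial blank of the
    control tape the entry point of the program. *)
Definition plain (x : A) : A * option (control c) := (x, Some (entry c)).

Lemma plain_neq : plain o != plain b.
Proof. by apply: contra o_neq_b => /eqP[->]. Qed.

(** State [Some false] executes the program (and receives the answers),
    [Some true] is the query state, and [None] the halting state. *)
Definition prog_transition (s : option bool) (sc : option I -> A * option (control c)) :
    option bool * (option I -> (A * option (control c)) * direction) :=
  if (sc None).2 is Some q then
    let r := next (fun i => (sc (Some i)).1) q in
    (Some (~~ r.2),
     fun i => if i is Some j then
                if r.2 is Some f then (plain (f j).1, (f j).2) else (sc i, Stay)
              else ((b, r.1), Stay))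
  else (None, fun i => (sc i, Stay)).

Definition prog_machine : oracle_machine :=
  @OracleMachine (option bool) (A * option (control c))%type (option I)
    (plain b) (plain o) plain_neq (Some false) (Some true) (Some false) None
    (Some inp) (Some out) (Some qt) prog_transition.

Definition lift_tapes (q : option (control c)) (ts : I -> cells) :
    tape_index prog_machine -> tape prog_machine :=
  fun i z => if i is Some j then plain (ts j z)
             else if z == 0 then (b, q) else plain b.

Lemma lift_ones q ts x j : ts j = ones x -> lift_tapes q ts (Some j) = unary prog_machine x.
Proof.
by move=> E; apply/funext => z; rewrite /lift_tapes E; case: z => [k|k] //=; case: ifP.
Qed.

Local Notation star g := (clos_refl_trans (config prog_machine) (@step prog_machine g)).

Lemma acts_star g q ts1 ts2 : acts g (next (scan ts1) q).2 ts1 ts2 ->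
  star g (Some false, lift_tapes (Some q) ts1)
         (Some false, lift_tapes (next (scan ts1) q).1 ts2).
Proof.
set r := next _ _ => a.
have tr := @step_transition prog_machine g (Some false) (lift_tapes (Some q) ts1) isT isT.
have E : @transition prog_machine (Some false) (fun i => lift_tapes (Some q) ts1 i 0) =
  (Some (~~ r.2),
     fun i => if i is Some j then
                if r.2 is Some f then (plain (f j).1, (f j).2) else (plain (ts1 j 0), Stay)
              else ((b, r.1), Stay)).
  by rewrite /= /prog_transition /= -/r; congr (_, _); apply/funext => -[j|].
rewrite {}E /= in tr.
clearbody r; case: r => [q' f] /= in a tr *.
case: a tr => {ts1 ts2 f} [f ts1|ts1 x tsE] tr.
  apply: rt_step; move: tr; set u := (X in step g _ (_, X)).
  suff -> : u = lift_tapes q' (fun i => write_move (ts1 i) (f i)) by [].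
  apply/funext => -[j|]; apply/funext => z; rewrite /u /tape_update /write_move /=.
    by case: (f j).2; case: ifP.
  by case: (z == 0).
move: tr; set u := (X in step g _ (_, X)) => tr.
have uE : u = lift_tapes q' ts1.
  apply/funext => -[j|]; apply/funext => z; rewrite /u /tape_update /=;
    by case: eqP => [zE|//]; rewrite ?zE.
rewrite uE in tr; apply: rt_trans (rt_step _ _ _ _ tr) _.
have := @step_query prog_machine g (lift_tapes q' ts1) x isT (lift_ones _ tsE).
set v := (X in step g _ (_, X)) => st; apply: rt_step.
suff <- : v = lift_tapes q' (fun i => if i == qt then ones (g x) else ts1 i) by [].
apply/funext => -[j|]; rewrite /v /=; last by [].
have -> : (Some j == Some qt) = (j == qt) by [].
case: eqP => [->|jq].
  by symmetry; apply: (@lift_ones q' _ (g x) qt); rewrite eqxx.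
by apply/funext => z; rewrite /lift_tapes; case: eqP jq.
Qed.

Lemma runs_star g q ts1 ts2 : runs g q ts1 ts2 ->
  star g (Some false, lift_tapes q ts1) (Some false, lift_tapes None ts2).
Proof.
elim=> [ts|{}q {}ts1 ts1' {}ts2 a _ IH]; first exact: rt_refl.
exact: rt_trans (acts_star a) IH.
Qed.

(** What programs are for: total correctness of a program in the big-step
    semantics gives a Turing reduction. *)
Lemma prog_turing_le f g :
  (forall x, exists2 ts, exec g c (fun i => if i == inp then ones x else ones 0) ts
                       & ts out = ones (f x)) ->
  turing_le f g.
Proof.
move=> cP; exists prog_machine => x; have [ts /exec_runs/runs_star r outE] := cP x.
exists (None, lift_tapes None ts); split=> //; last exact: lift_ones.
have := @step_transition prog_machine g (Some false) (lift_tapes None ts) isT isT.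
rewrite /=; set u := (X in step g _ (_, X)) => st.
have <- : u = lift_tapes None ts.
  apply/funext => -[j|]; apply/funext => z; rewrite /u /tape_update /=;
    by case: eqP => [zE|//]; rewrite ?zE.
apply: rt_trans (rt_step _ _ _ _ st).
move: r; set v := lift_tapes (Some _) _.
suff -> : v = (init_config prog_machine x).2 by [].
apply/funext => -[j|]; apply/funext => -[z|z]; rewrite /v //=.
- have -> : (Some j == Some inp) = (j == inp) by [].
  by case: eqP => _ //=; case: ifP.
- have -> : (Some j == Some inp) = (j == inp) by [].
  by case: eqP => _ //=; case: ifP.
- by case: (_ == _).
Qed.

End Compile.
End TapePrograms.

(** * Registers, and an oracle machine used as a subroutine *)
Section Registers.
Variables (M : oracle_machine) (N : nat) (g : nat -> nat).

Local Notation I := ('I_N.+1 + option (tape_index M))%type.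
Local Notation A := (symbol M * state M)%type.

(** Tapes [inl r] are registers in unary; [inr (Some i)] is tape [i] of the
    subroutine [M], and the current cell of [inr None] holds the state of [M].
    As in the control tape above, the state component is [start_state M] on all
    other cells, so that an untouched tape encodes an idle [M]. *)
Definition rblank : A := (blank M, start_state M).
Definition rone : A := (Defs.one M, start_state M).
Definition reg (r : nat) : I := inl (inord r).
Definition qtape : I := inr (Some (query_tape M)).

Local Notation exec := (@exec I A rblank rone qtape g).
Local Notation prog := (prog I A).

Definition conf (rho : nat -> nat) (s : state M) (ts : tape_index M -> tape M) :
    I -> cells A := fun i =>
  match i with
  | inl r => ones rblank rone (rho r)
  | inr None => fun z => if z == 0 then (blank M, s) else rblank
  | inr (Some j) => fun z => (ts j z, start_state M)
  end.

(** The configurations between calls: all tapes of [M] are blank, so that [M]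
    can be started again. *)
Definition clean rho := conf rho (start_state M) (fun=> unary M 0).

Definition upd (rho : nat -> nat) (r v : nat) : nat -> nat :=
  fun j => if j == r then v else rho j.

Lemma upd_id rho r : upd rho r (rho r) = rho.
Proof. by apply/funext => j; rewrite /upd; case: eqP => // ->. Qed.

Lemma upd_eq rho r v : upd rho r v r = v.
Proof. by rewrite /upd eqxx. Qed.

Lemma exec_conv c ts1 ts2 ts1' ts2' :
  exec c ts1 ts2 -> ts1 = ts1' -> ts2 = ts2' -> exec c ts1' ts2'.
Proof. by move=> e <- <-. Qed.

Lemma exec_while_conv (t : (I -> A) -> bool) c n (s : nat -> I -> cells A) ts1 ts2 :
  (forall k, (k < n)%N -> t (scan (s k))) -> ~~ t (scan (s n)) ->
  (forall k, (k < n)%N -> exec c (s k) (s k.+1)) ->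
  s 0%N = ts1 -> s n = ts2 -> exec (While t c) ts1 ts2.
Proof. by move=> h1 h2 h3 <- <-; apply: exec_while_iter. Qed.

Lemma eq_reg (i : 'I_N.+1) r : (r <= N)%N -> ((inl i : I) == reg r) = (nat_of_ord i == r).
Proof.
move=> rN; rewrite /reg; apply/eqP/eqP => [[->]|<-]; first by rewrite inordK.
by rewrite inord_val.
Qed.

Lemma inr_neq_reg (j : option (tape_index M)) r : ((inr j : I) == reg r) = false.
Proof. by []. Qed.

Definition inc (r : nat) : prog :=
  Seq (Act (fun sc j => (sc j, if j == reg r then Left else Stay)))
      (Act (fun sc j => (if j == reg r then rone else sc j, Stay))).

Definition dec (r : nat) : prog :=
  Act (fun sc j => if j == reg r then (rblank, Right) else (sc j, Stay)).

Definition nonzero (r : nat) (sc : I -> A) : bool := (sc (reg r)).1 == Defs.one M.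

Lemma write_stay (t : cells A) : write_move t (t 0, Stay) = t.
Proof. by apply/funext => z; rewrite /write_move /=; case: eqP => [->|]. Qed.

(** Since cells are numbered from the head, moving left and writing a one
    adds one to a unary number, and erasing and moving right subtracts one. *)
Lemma ones_cons x : write_move (write_move (ones rblank rone x)
    (ones rblank rone x 0, Left)) (rone, Stay) = ones rblank rone x.+1.
Proof.
apply/funext => -[[|z]|z] //.
have E : Posz z.+1 - 1 = z by lia.
by rewrite /write_move [LHS]/= E; case: z {E}.
Qed.

Lemma ones_behead x :
  write_move (ones rblank rone x) (rblank, Right) = ones rblank rone x.-1.
Proof.
apply/funext => -[z|[|z]] //.
have E : Posz z + 1 = z.+1 by lia.
by rewrite /write_move [LHS]/= E /= addn1 ltn_predRL.
Qed.

Lemma exec_inc rho s ts r : (r <= N)%N ->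
  exec (inc r) (conf rho s ts) (conf (upd rho r (rho r).+1) s ts).
Proof.
move=> rN; apply: exec_seq (exec_act _ _ _ _ _ _) _.
apply: exec_conv (exec_act _ _ _ _ _ _) erefl _.
apply/funext => -[i|j]; rewrite /scan; last by rewrite inr_neq_reg !write_stay.
rewrite eq_reg // [RHS]/= /upd; case: eqP => [E|_]; last by rewrite !write_stay.
by rewrite -E /=; apply: ones_cons.
Qed.

Lemma exec_dec rho s ts r : (r <= N)%N ->
  exec (dec r) (conf rho s ts) (conf (upd rho r (rho r).-1) s ts).
Proof.
move=> rN; apply: exec_conv (exec_act _ _ _ _ _ _) erefl _.
apply/funext => -[i|j]; rewrite /scan; last by rewrite inr_neq_reg write_stay.
rewrite eq_reg // [RHS]/= /upd; case: eqP => [E|_]; last by rewrite write_stay.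
by rewrite -E /=; apply: ones_behead.
Qed.

Lemma blank_neq_one : (blank M == Defs.one M) = false.
Proof. by rewrite eq_sym; apply/negbTE/one_neq_blank. Qed.

Lemma nonzero_conf rho s ts r : (r <= N)%N ->
  nonzero r (scan (conf rho s ts)) = (0 < rho r)%N.
Proof.
by move=> rN; rewrite /nonzero /scan /= inordK //; case: (rho r) => [|n];
  rewrite /= ?eqxx // blank_neq_one.
Qed.

Ltac regs := apply/funext => j; rewrite /upd; repeat (case: eqP => ?); subst; lia.

Definition clear r := While (nonzero r) (dec r).

Lemma exec_clear rho s ts r : (r <= N)%N ->
  exec (clear r) (conf rho s ts) (conf (upd rho r 0) s ts).
Proof.
move=> rN.
apply: (@exec_while_conv _ _ (rho r) (fun k => conf (upd rho r (rho r - k)) s ts)).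
- by move=> k kn; rewrite nonzero_conf // /upd eqxx subn_gt0.
- by rewrite nonzero_conf // /upd eqxx subnn.
- move=> k kn; apply: exec_conv (exec_dec _ _ _ rN) erefl _.
  by congr conf; regs.
- by rewrite subn0 upd_id.
- by rewrite subnn.
Qed.

Definition transfer r r' := While (nonzero r) (Seq (dec r) (inc r')).

Lemma exec_transfer rho s ts r r' : (r <= N)%N -> (r' <= N)%N -> r != r' ->
  exec (transfer r r') (conf rho s ts)
    (conf (upd (upd rho r 0) r' (rho r' + rho r)) s ts).
Proof.
move=> rN rN' /eqP rr'.
apply: (@exec_while_conv _ _ (rho r)
  (fun k => conf (upd (upd rho r (rho r - k)) r' (rho r' + k)) s ts)).
- by move=> k kn; rewrite nonzero_conf // /upd eqxx; case: eqP => //; lia.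
- by rewrite nonzero_conf // /upd eqxx subnn; case: eqP => //; lia.
- move=> k kn; apply: exec_seq (exec_dec _ _ _ rN) _.
  apply: exec_conv (exec_inc _ _ _ rN') erefl _.
  by congr conf; regs.
- by congr conf; regs.
- by congr conf; regs.
Qed.

Definition copy r r' t :=
  Seq (While (nonzero r) (Seq (dec r) (Seq (inc r') (inc t)))) (transfer t r).

Lemma exec_copy rho s ts r r' t : (r <= N)%N -> (r' <= N)%N -> (t <= N)%N ->
  r != r' -> r != t -> r' != t -> rho r' = 0%N -> rho t = 0%N ->
  exec (copy r r' t) (conf rho s ts) (conf (upd rho r' (rho r)) s ts).
Proof.
move=> rN rN' tN /eqP rr' /[dup] rt /eqP ? /eqP rt' r'0 t0.
apply: (@exec_seq _ _ _ _ _ _ _ _ _ (conf (upd (upd (upd rho r 0) r' (rho r)) t (rho r)) s ts)).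
  apply: (@exec_while_conv _ _ (rho r)
    (fun k => conf (upd (upd (upd rho r (rho r - k)) r' k) t k) s ts)).
  - by move=> k kn; rewrite nonzero_conf // /upd; repeat (case: eqP => ?); subst; lia.
  - by rewrite nonzero_conf // /upd; repeat (case: eqP => ?); subst; lia.
  - move=> k kn; apply: exec_seq (exec_dec _ _ _ rN) _.
    apply: exec_seq (exec_inc _ _ _ rN') _.
    apply: exec_conv (exec_inc _ _ _ tN) erefl _.
    by congr conf; regs.
  - by congr conf; regs.
  - by congr conf; regs.
apply: exec_conv (exec_transfer _ _ _ tN rN _) erefl _; first by rewrite eq_sym.
by congr conf; regs.
Qed.

Section Call.

(** One step on the tapes and the state of [M]; its transition function is
    the instance used to simulate it. *)
Definition mact (F : state M -> (tape_index M -> symbol M) ->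
    state M * (tape_index M -> symbol M * direction)) : prog :=
  Act (fun sc j =>
    let r := F (sc (inr None)).2 (fun i => (sc (inr (Some i))).1) in
    match j with
    | inl _ => (sc j, Stay)
    | inr None => ((blank M, r.1), Stay)
    | inr (Some i) => (((r.2 i).1, start_state M), (r.2 i).2)
    end).

Lemma exec_mact F rho s ts : exec (mact F) (conf rho s ts)
  (conf rho (F s (fun i => ts i 0)).1
        (fun i => tape_update (ts i) ((F s (fun i => ts i 0)).2 i))).
Proof.
apply: exec_conv (exec_act _ _ _ _ _ _) erefl _.
apply/funext => -[i|[i|]]; rewrite /scan.
- by rewrite write_stay.
- apply/funext => z; set r := F s (fun i => ts i 0).
  change (write_move (fun z => (ts i z, start_state M))
    (((r.2 i).1, start_state M), (r.2 i).2) z = (tape_update (ts i) (r.2 i) z, start_state M)).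
  by rewrite /write_move /tape_update /=; case: (r.2 i).2; case: ifP.
- by apply/funext => z; rewrite /= /write_move /=; case: (z == 0).
Qed.

Definition set_state s' := mact (fun _ sy => (s', fun i => (sy i, Stay))).
Definition edit (F : tape_index M -> symbol M -> symbol M * direction) :=
  mact (fun s sy => (s, fun i => F i (sy i))).

Lemma tape_update_stay (t : tape M) : tape_update t (t 0, Stay) = t.
Proof. by apply/funext => z; rewrite /tape_update /=; case: eqP => [->|]. Qed.

Lemma exec_set_state s' rho s ts :
  exec (set_state s') (conf rho s ts) (conf rho s' ts).
Proof.
apply: exec_conv (exec_mact _ _ _ _) erefl _; congr conf.
by apply/funext => i; rewrite /= tape_update_stay.
Qed.

Lemma exec_edit F rho s ts : exec (edit F) (conf rho s ts)
  (conf rho s (fun i => tape_update (ts i) (F i (ts i 0)))).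
Proof. exact: exec_mact. Qed.

Definition shift (t : tape M) (d : int) : tape M := fun z => t (z + d).

Lemma tape_update_right t : tape_update t (t 0, Right) = shift t 1.
Proof. by apply/funext => z; rewrite /tape_update /shift /=; case: eqP => [->|]. Qed.

Lemma tape_update_left t : tape_update t (t 0, Left) = shift t (-1).
Proof. by apply/funext => z; rewrite /tape_update /shift /=; case: eqP => [->|]. Qed.

Lemma shiftD t d e : shift (shift t d) e = shift t (d + e).
Proof. by apply/funext => z; rewrite /shift addrAC addrA. Qed.

Lemma shift0 t : shift t 0 = t.
Proof. by apply/funext => z; rewrite /shift addr0. Qed.

Definition set_tape (ts : tape_index M -> tape M) i t : tape_index M -> tape M :=
  fun j => if j == i then t else ts j.

Lemma set_tape_id ts i : set_tape ts i (ts i) = ts.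
Proof. by apply/funext => j; rewrite /set_tape; case: eqP => // ->. Qed.

Lemma set_tape_set ts i t t' : set_tape (set_tape ts i t) i t' = set_tape ts i t'.
Proof. by apply/funext => j; rewrite /set_tape; case: eqP. Qed.

Lemma set_tape_eq ts i t : set_tape ts i t i = t.
Proof. by rewrite /set_tape eqxx. Qed.

Definition edit1 i (f : symbol M -> symbol M * direction) :=
  edit (fun j a => if j == i then f a else (a, Stay)).

Lemma exec_edit1 i f rho s ts : exec (edit1 i f) (conf rho s ts)
  (conf rho s (set_tape ts i (tape_update (ts i) (f (ts i 0))))).
Proof.
apply: exec_conv (exec_edit _ _ _ _) erefl _; congr conf.
apply/funext => j; rewrite /set_tape; case: eqP => [->|] //.
by rewrite tape_update_stay.
Qed.

Definition scans_one i (sc : I -> A) := (sc (inr (Some i))).1 == Defs.one M.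
Definition in_state s' (sc : I -> A) := (sc (inr None)).2 == s'.

Lemma in_state_conf s' rho s ts : in_state s' (scan (conf rho s ts)) = (s == s').
Proof. by []. Qed.

Lemma scans_one_conf i rho s ts : scans_one i (scan (conf rho s ts)) = (ts i 0 == Defs.one M).
Proof. by []. Qed.

Lemma unary_one x k : (k <= x)%N -> (shift (unary M x) k 0 == Defs.one M) = (k < x)%N.
Proof. by move=> kx; rewrite /shift add0r /=; case: ifP; rewrite ?eqxx // blank_neq_one. Qed.

Variable a : nat.
Hypothesis aN : (a.+2 <= N)%N.
Let aN0 : (a <= N)%N. Proof. lia. Qed.
Let aN1 : (a.+1 <= N)%N. Proof. lia. Qed.
Local Notation clock := a.+1.
Local Notation aux := a.+2.

(** The register [clock] counts the cells that [M] may have visited on either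
    side of its heads: the length of the input here, two per simulated step, and
    the lengths of oracle answers and of the output.  It tells [wipe] how far
    it has to erase. *)
Definition load :=
  While (nonzero a)
    (Seq (dec a) (Seq (inc clock)
    (Seq (edit1 (input_tape M) (fun x => (x, Left)))
         (edit1 (input_tape M) (fun=> (Defs.one M, Stay)))))).

Lemma unary_cons x : tape_update (shift (unary M x) (-1)) (Defs.one M, Stay) = unary M x.+1.
Proof.
apply/funext => -[[|z]|z] //.
have E : Posz z.+1 - 1 = z by lia.
by change (unary M x (Posz z.+1 - 1) = unary M x.+1 z.+1); rewrite E.
Qed.

Lemma exec_load rho : rho clock = 0%N ->
  exec load (clean rho)
    (conf (upd (upd rho a 0) clock (rho a)) (start_state M) (init_config M (rho a)).2).
Proof.
move=> c0; rewrite /clean.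
apply: (@exec_while_conv _ _ (rho a) (fun k =>
  conf (upd (upd rho a (rho a - k)) clock k) (start_state M) (init_config M k).2)).
- by move=> k kn; rewrite nonzero_conf // /upd; repeat (case: eqP => ?); lia.
- by rewrite nonzero_conf // /upd; repeat (case: eqP => ?); lia.
- move=> k kn; apply: exec_seq (exec_dec _ _ _ aN0) _.
  apply: exec_seq (exec_inc _ _ _ aN1) _.
  apply: exec_seq (exec_edit1 _ _ _ _ _) _.
  apply: exec_conv (exec_edit1 _ _ _ _ _) erefl _; congr conf; first by regs.
  apply/funext => j; rewrite set_tape_set /set_tape /= !eqxx.
  case: eqP => // _.
  by rewrite tape_update_left unary_cons.
- by congr conf; first regs; apply/funext => j /=; case: ifP.
- by rewrite subnn.
Qed.

(** A query may replace a short number by a long one in a single step, which is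
    why the answer has to be measured: its ones are counted into [clock] and
    [aux], and [aux] then brings the head back. *)
Definition measure_query :=
  Seq (While (scans_one (query_tape M))
        (Seq (edit1 (query_tape M) (fun x => (x, Right))) (Seq (inc clock) (inc aux))))
      (While (nonzero aux)
        (Seq (dec aux) (edit1 (query_tape M) (fun x => (x, Left))))).

Lemma exec_measure_query rho s ts x : rho aux = 0%N -> ts (query_tape M) = unary M x ->
  exec measure_query (conf rho s ts) (conf (upd rho clock (rho clock + x)) s ts).
Proof.
move=> r0 tsE.
apply: (@exec_seq _ _ _ _ _ _ _ _ _ (conf (upd (upd rho clock (rho clock + x)) aux x) s
  (set_tape ts (query_tape M) (shift (unary M x) x)))).
  apply: (@exec_while_conv _ _ x (fun k => conf (upd (upd rho clock (rho clock + k)) aux k)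
    s (set_tape ts (query_tape M) (shift (unary M x) k)))) => //.
  - by move=> k kn; rewrite scans_one_conf /set_tape eqxx unary_one // ltnW.
  - by rewrite scans_one_conf /set_tape eqxx unary_one // ltnn.
  - move=> k kn; apply: exec_seq (exec_edit1 _ _ _ _ _) _.
    apply: exec_seq (exec_inc _ _ _ aN1) _.
    apply: exec_conv (exec_inc _ _ _ aN) erefl _; congr conf; first by regs.
    rewrite set_tape_set !set_tape_eq tape_update_right shiftD.
    by congr (set_tape _ _ (shift _ _)); lia.
  - congr conf; first by regs.
    by rewrite shift0 -tsE set_tape_id.
apply: (@exec_while_conv _ _ x (fun k => conf (upd (upd rho clock (rho clock + x)) aux (x - k))
    s (set_tape ts (query_tape M) (shift (unary M x) (x - k)%N)))).
- by move=> k kn; rewrite nonzero_conf // /upd eqxx; lia.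
- by rewrite nonzero_conf // /upd eqxx; lia.
- move=> k kn; apply: exec_seq (exec_dec _ _ _ aN) _.
  apply: exec_conv (exec_edit1 _ _ _ _ _) erefl _; congr conf; first by regs.
  rewrite set_tape_set !set_tape_eq tape_update_left shiftD.
  by congr (set_tape _ _ (shift _ _)); lia.
- by rewrite subn0.
- rewrite subnn shift0 -tsE set_tape_id; congr conf; regs.
Qed.

Definition simulate :=
  While (fun sc => ~~ in_state (halt_state M) sc)
    (Seq (inc clock) (Seq (inc clock)
      (If (in_state (query_state M))
          (Seq (Query _ _) (Seq (set_state (answer_state M)) measure_query))
          (mact (@transition M))))).

(** The left end is included and the right end is not, so that after moving
    left [n] times, erasing [2 n] cells to the right clears everything. *)
Definition bounded (n : nat) (t : tape M) :=
  forall z, t z != blank M -> (- n%:Z <= z) && (z < n%:Z).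

(** One more cell does not suffice: a symbol written at the origin of a blank
    tape must be within the bound after a move in either direction. *)
Lemma bounded_update n t u : bounded n t -> bounded n.+2 (tape_update t u).
Proof.
move=> tn z; rewrite /tape_update.
by case: u.2 => /=; case: (_ =P 0 :> int) => [z0 _|_ /tn]; lia.
Qed.

Lemma bounded_le n p t : (n <= p)%N -> bounded n t -> bounded p t.
Proof. by move=> np tn z /tn; lia. Qed.

Lemma unary_nonblank x z : unary M x z != blank M -> (0 <= z) && (z < x%:Z).
Proof. by case: z => [z|z] /=; [case: ifP|]; rewrite ?eqxx //; lia. Qed.

Lemma bounded_unary x : bounded x (unary M x).
Proof. by move=> z /unary_nonblank; lia. Qed.

(** By induction on a halting run of [M], which the loop follows step by step;
    [T] is the value of the clock at the end. *)
Lemma exec_simulate (c c' : config M) : clos_refl_trans_1n _ (@step M g) c c' ->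
  c'.1 = halt_state M ->
  forall rho, rho aux = 0%N -> (forall i, bounded (rho clock) (c.2 i)) ->
  exists2 T, forall i, bounded T (c'.2 i) &
    exec simulate (conf rho c.1 c.2) (conf (upd rho clock T) (halt_state M) c'.2).
Proof.
elim=> {c c'} [c cH rho r0 cb|c c1 c2 st _ IH cH rho r0 cb].
  exists (rho clock) => //; rewrite upd_id cH; apply: exec_while_stop.
  by rewrite in_state_conf eqxx.
have {}IH := IH cH.
set rho2 := upd rho clock (rho clock).+2.
have rho2c : rho2 clock = (rho clock).+2 by rewrite /rho2 /upd eqxx.
have [rho1 [r10 c1b e1]] : exists rho1, [/\ upd rho1 clock 0 = upd rho clock 0,
    forall i, bounded (rho1 clock) (c1.2 i) &
    exec (If (in_state (query_state M))
          (Seq (Query _ _) (Seq (set_state (answer_state M)) measure_query))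
          (mact (@transition M))) (conf rho2 c.1 c.2) (conf rho1 c1.1 c1.2)].
  case: st cb => {c c1 c2 IH cH} [s ts sh sq|ts x qh tsE] cb.
    exists rho2; split; first by rewrite /rho2; regs.
      by move=> i; rewrite rho2c; apply: bounded_update.
    by apply: exec_if; rewrite in_state_conf (negbTE sq); apply: exec_mact.
  exists (upd rho2 clock (rho2 clock + g x)); split; first by rewrite /rho2; regs.
    move=> i /=; rewrite {1}/upd eqxx rho2c; case: eqP => _.
      by apply: @bounded_le _ _ _ _ (@bounded_unary _); lia.
    by apply: @bounded_le _ _ _ _ (cb i); rewrite /=; lia.
  apply: exec_if; rewrite in_state_conf eqxx.
  apply: exec_seq.
    apply: (@exec_query _ _ _ _ _ _ _ x).
    apply/funext => z; rewrite /= tsE; case: z => // z /=; by case: ifP.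
  pose ts' i := if i == query_tape M then unary M (g x) else ts i.
  apply: (@exec_seq _ _ _ _ _ _ _ _ _ (conf rho2 (answer_state M) ts')).
    apply: exec_conv (exec_set_state _ _ (query_state M) _) _ erefl.
    apply/funext => -[i|[i|]] //=; rewrite /ts'.
    have -> : ((inr (Some i) : I) == qtape) = (i == query_tape M).
      by apply/eqP/eqP => [[]|->].
    by case: eqP => // _; apply/funext => -[z|z] //=; case: ifP.
  apply: exec_measure_query; last by rewrite /ts' eqxx.
  by rewrite /rho2 /upd; case: eqP => //; lia.
have r1E j : j != clock -> rho1 j = rho j.
  by move=> /negbTE jc; have := congr1 (fun f => f j) r10; rewrite /upd jc.
have [||T Tb e] := IH rho1; [by rewrite r1E //; lia|by []|].
exists T => //; apply: exec_while_step.
- rewrite in_state_conf; case: st => [s ts|ts x] //=.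
- apply: exec_seq (exec_inc _ _ _ aN1) _.
  apply: exec_seq (exec_inc _ _ _ aN1) _.
  apply: exec_conv e1 _ erefl; congr conf; rewrite /rho2; regs.
- apply: exec_conv e erefl _; congr conf.
  by apply/funext => j; rewrite /upd; case: eqP => // /eqP; apply: r1E.
Qed.

Definition unload :=
  While (scans_one (output_tape M))
    (Seq (inc clock) (Seq (inc a) (edit1 (output_tape M) (fun x => (x, Right))))).

Lemma exec_unload rho s ts y : rho a = 0%N -> ts (output_tape M) = unary M y ->
  exec unload (conf rho s ts)
    (conf (upd (upd rho clock (rho clock + y)) a y) s
      (set_tape ts (output_tape M) (shift (unary M y) y))).
Proof.
move=> a0 tsE.
apply: (@exec_while_conv _ _ y (fun k => conf (upd (upd rho clock (rho clock + k)) a k)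
    s (set_tape ts (output_tape M) (shift (unary M y) k)))) => //.
- by move=> k kn; rewrite scans_one_conf /set_tape eqxx unary_one // ltnW.
- by rewrite scans_one_conf /set_tape eqxx unary_one // ltnn.
- move=> k kn; apply: exec_seq (exec_inc _ _ _ aN1) _.
  apply: exec_seq (exec_inc _ _ _ aN0) _.
  apply: exec_conv (exec_edit1 _ _ _ _ _) erefl _; congr conf; first by regs.
  rewrite set_tape_set !set_tape_eq tape_update_right shiftD.
  by congr (set_tape _ _ (shift _ _)); lia.
- congr conf; first by regs.
  by rewrite shift0 -tsE set_tape_id.
Qed.

(** Cells are numbered from the head, so that a completely blank tape is the
    initial one wherever the head has come to rest. *)
Definition wipe :=
  Seq (While (nonzero clock)
        (Seq (dec clock) (Seq (inc aux) (Seq (inc aux) (edit (fun _ x => (x, Left)))))))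
  (Seq (While (nonzero aux) (Seq (dec aux) (edit (fun _ _ => (blank M, Right)))))
       (set_state (start_state M))).

Lemma exec_wipe rho s ts : rho aux = 0%N -> (forall i, bounded (rho clock) (ts i)) ->
  exec wipe (conf rho s ts) (clean (upd rho clock 0)).
Proof.
move=> r0; set T := rho clock => tsT.
apply: (@exec_seq _ _ _ _ _ _ _ _ _ (conf (upd (upd rho clock 0) aux (T * 2)) s
  (fun i => shift (ts i) (- T%:Z)))).
  apply: (@exec_while_conv _ _ T (fun k => conf (upd (upd rho clock (T - k)) aux (k * 2)) s
    (fun i => shift (ts i) (- k%:Z)))).
  - by move=> k kn; rewrite nonzero_conf // /upd; repeat (case: eqP => ?); lia.
  - by rewrite nonzero_conf // /upd; repeat (case: eqP => ?); lia.
  - move=> k kn; apply: exec_seq (exec_dec _ _ _ aN1) _.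
    apply: exec_seq (exec_inc _ _ _ aN) _; apply: exec_seq (exec_inc _ _ _ aN) _.
    apply: exec_conv (exec_edit _ _ _ _) erefl _; congr conf; first by regs.
    apply/funext => i; rewrite tape_update_left shiftD; congr shift; lia.
  - by congr conf; [regs|apply/funext => i; rewrite oppr0 shift0].
  - by congr conf; regs.
apply: (@exec_seq _ _ _ _ _ _ _ _ _ (conf (upd rho clock 0) s (fun=> unary M 0)));
  last exact: exec_set_state.
apply: (@exec_while_conv _ _ (T * 2)%N (fun k => conf (upd (upd rho clock 0) aux (T * 2 - k)) s
    (fun i z => if z < 0 then blank M else ts i (z + k%:Z - T%:Z)))).
- by move=> k kn; rewrite nonzero_conf // /upd; repeat (case: eqP => ?); lia.
- by rewrite nonzero_conf // /upd; repeat (case: eqP => ?); lia.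
- move=> k kn; apply: exec_seq (exec_dec _ _ _ aN) _.
  apply: exec_conv (exec_edit _ _ _ _) erefl _; congr conf; first by regs.
  apply/funext => i; apply/funext => z; rewrite /tape_update /=.
  case: (z + 1 =P 0) => [z0|/eqP z0]; first by rewrite ifT //; lia.
  have -> : (z + 1 < 0) = (z < 0) by lia.
  by case: ifP => // _; congr (ts i _); lia.
- congr conf; first by regs.
  apply/funext => i; apply/funext => z; rewrite /shift addr0; case: ifP => // z0.
  by apply/eqP/negPn/negP => /negPf/negbT; rewrite eq_sym => /tsT; lia.
- congr conf; first by regs.
  apply/funext => i; apply/funext => z.
  have -> : unary M 0 z = blank M by case: z.
  case: ifP => // z0.
  by apply/eqP/negPn/negP => /tsT; lia.
Qed.

Definition call := Seq load (Seq simulate (Seq unload wipe)).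

(** The point of the section: a function reducible to the oracle [g] becomes a
    single instruction, which can be repeated since it leaves no traces. *)
Lemma exec_call (h : nat -> nat) rho : computes_with_oracle M g h ->
  rho clock = 0%N -> rho aux = 0%N ->
  exec call (clean rho) (clean (upd rho a (h (rho a)))).
Proof.
move=> Mh c0 r0; have [c [cst ch cout]] := Mh (rho a).
apply: exec_seq (exec_load c0) _.
have := exec_simulate (clos_rt_rt1n _ _ _ _ cst) ch.
move=> /(_ (upd (upd rho a 0) clock (rho a))) [||T Tb e].
- by rewrite /upd; repeat (case: eqP => ?); lia.
- move=> i; rewrite {1}/upd eqxx /=; case: ifP => _; first exact: (@bounded_unary _).
  by apply: @bounded_le _ _ _ _ (@bounded_unary _).
apply: exec_seq e _.
apply: exec_seq (exec_unload _ _ cout) _.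
  by rewrite /upd; repeat (case: eqP => ?); lia.
set y := h (rho a).
apply: exec_conv (exec_wipe _ _ _) erefl _.
- by rewrite /upd; repeat (case: eqP => ?); lia.
- move=> i; set n := upd _ a y clock.
  have -> : n = (T + y)%N by rewrite /n /upd; repeat (case: eqP => ?); lia.
  rewrite /set_tape; case: eqP => _; last by apply: @bounded_le _ _ _ _ (Tb i); lia.
  by move=> z /unary_nonblank; lia.
- by congr clean; regs.
Qed.

End Call.
End Registers.

(** * Primitive recursion relative to an oracle *)

(** Primitive recursive expressions in de Bruijn style: [ERec n x y] binds the
    step counter (variable 0) and the value reached so far (variable 1) in [y].
    The weakening [EWk] is a constructor, so that the derived operations below
    can use their arguments under a binder by merely wrapping them. *)
Inductive expr :=
| EVar of nat
| EZero
| ESucc of expr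
| ERec of expr & expr & expr
| EWk of nat & expr
| EOrc of expr.

Section Expr.
Variable h : nat -> nat.

Fixpoint eval (rho : seq nat) (e : expr) : nat :=
  match e with
  | EVar i => nth 0%N rho i
  | EZero => 0%N
  | ESucc e => (eval rho e).+1
  | ERec en e0 es =>
      iteri (eval rho en) (fun k acc => eval [:: k, acc & rho] es) (eval rho e0)
  | EWk n e => eval (drop n rho) e
  | EOrc e => h (eval rho e)
  end.

Section Compile.
Variables (M : oracle_machine) (N : nat) (g : nat -> nat).
Hypothesis Mh : computes_with_oracle M g h.

Local Notation I := ('I_N.+1 + option (tape_index M))%type.
Local Notation A := (symbol M * state M)%type.
Local Notation exec := (@exec I A (rblank M) (rone M) (qtape M N) g).
Local Notation prog := (prog I A).

(** The registers [vs] hold the free variables, the value goes to register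
    [d], and everything above [d] is scratch space, zero before and after. *)
Fixpoint compile (e : expr) (vs : seq nat) (d : nat) : prog :=
  match e with
  | EVar i => if (i < size vs)%N then copy M N (nth 0%N vs i) d d.+1 else clear M N d
  | EZero => clear M N d
  | ESucc e => Seq (compile e vs d) (inc M N d)
  | ERec en e0 es =>
      Seq (compile en vs d) (Seq (compile e0 vs d.+1)
      (Seq (While (nonzero d)
              (Seq (dec M N d) (Seq (compile es [:: d.+2, d.+1 & vs] d.+3)
              (Seq (clear M N d.+1) (Seq (transfer M N d.+3 d.+1) (inc M N d.+2))))))
           (Seq (clear M N d.+2) (transfer M N d.+1 d))))
  | EWk n e => compile e (drop n vs) d
  | EOrc e => Seq (compile e vs d) (call M N d)
  end.

Fixpoint need (e : expr) (d : nat) : nat :=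
  match e with
  | EVar _ => d.+1
  | EZero => d
  | ESucc e => need e d
  | ERec en e0 es => maxn (need en d) (maxn (need e0 d.+1) (need es d.+3))
  | EWk _ e => need e d
  | EOrc e => maxn (need e d) d.+2
  end.

Lemma need_ge e d : (d <= need e d)%N.
Proof. by elim: e d => //= [e1 IH1 e2 _ e3 _|e IH] *; rewrite ?leq_max ?IH1 ?IH. Qed.

Ltac regs := apply/funext => j; rewrite /upd; repeat (case: eqP => ?); subst;
  try congruence; lia.

Lemma map_upd rho d v vs : all (fun r => r < d)%N vs -> map (upd rho d v) vs = map rho vs.
Proof.
move=> /allP vsd; apply/eq_in_map => r /vsd; rewrite /upd.
by case: eqP => // ->; rewrite ltnn.
Qed.

Lemma upd_above (rho : nat -> nat) d v : (forall r, (d <= r)%N -> rho r = 0%N) ->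
  forall r, (d.+1 <= r)%N -> upd rho d v r = 0%N.
Proof. by move=> z r dr; rewrite /upd; case: eqP => [|_]; [lia|apply: z; lia]. Qed.

Lemma all_ltW vs d d' : (d <= d')%N -> all (fun r => r < d)%N vs -> all (fun r => r < d')%N vs.
Proof. by move=> dd'; apply: sub_all => r rd; apply: leq_trans dd'. Qed.

Lemma exec_compile e vs d rho : (need e d <= N)%N -> all (fun r => r < d)%N vs ->
  (forall r, (d <= r)%N -> rho r = 0%N) ->
  exec (compile e vs d) (@clean M N rho) (@clean M N (upd rho d (eval (map rho vs) e))).
Proof.
elim: e vs d rho => [i||e IH|en IHn e0 IH0 es IHs|n e IH|e IH] vs d rho /=.
- move=> dN vsd z; case: ltnP => i_vs.
    have vd : (nth 0%N vs i < d)%N := (allP vsd) _ (mem_nth 0%N i_vs).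
    rewrite (nth_map 0%N) //.
    by apply: exec_copy; try lia; apply: z; lia.
  rewrite nth_default ?size_map //.
  by apply: exec_clear; lia.
- by move=> dN vsd z; apply: exec_clear.
- move=> dN vsd z; apply: exec_seq (IH _ _ _ dN vsd z) _.
  have dN' : (d <= N)%N by apply: leq_trans (need_ge _ _) dN.
  apply: exec_conv (exec_inc _ _ _ _ dN') erefl _.
  by congr clean; regs.
- rewrite !geq_max => /and3P[dn d0 ds] vsd z; apply: exec_seq (IHn _ _ _ dn vsd z) _.
  have dN : (d.+3 <= N)%N by apply: leq_trans (need_ge _ _) ds.
  apply: exec_seq (IH0 _ _ _ d0 _ _) _; [exact: all_ltW vsd|exact: upd_above|].
  rewrite map_upd //.
  set n := eval _ en; set x0 := eval _ e0; set st := fun k acc => _.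
  have z1 := z d.+1 (leqnSn d).
  have z2 : rho d.+2 = 0%N by apply: z; lia.
  have z3 : rho d.+3 = 0%N by apply: z; lia.
  (* the register contents after k rounds of the loop *)
  pose sg k := upd (upd (upd rho d (n - k)) d.+1 (iteri k st x0)) d.+2 k.
  apply: (@exec_seq _ _ _ _ _ _ _ _ _ (@clean M N (sg n))).
    apply: (@exec_while_conv _ _ _ _ _ n (fun k => @clean M N (sg k))).
    + by move=> k kn; rewrite nonzero_conf /sg /upd; [repeat (case: eqP => ?)|]; lia.
    + by rewrite nonzero_conf /sg /upd; [repeat (case: eqP => ?)|]; lia.
    + move=> k kn; apply: exec_seq; first by apply: exec_dec; lia.
      apply: exec_seq (IHs [:: d.+2, d.+1 & vs] _ _ ds _ _) _.
      * by rewrite /= !ltnS leqnn leqnSn; apply: all_ltW vsd; lia.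
      * move=> r dr; rewrite /sg /upd; repeat (case: eqP => ?); try lia.
        by apply: z; lia.
      apply: exec_seq; first by apply: exec_clear; lia.
      apply: exec_seq; first by apply: exec_transfer; lia.
      apply: exec_conv (exec_inc _ _ _ _ _) erefl _; first by lia.
      congr clean.
      have -> : eval (map (upd (sg k) d (sg k d).-1) [:: d.+2, d.+1 & vs]) es =
                st k (iteri k st x0).
        rewrite /st; congr eval; rewrite /=; congr [:: _, _ & _].
        - by rewrite /sg /upd; repeat (case: eqP => ?); lia.
        - by rewrite /sg /upd; repeat (case: eqP => ?); try lia.
        - by rewrite /sg !map_upd //; apply: all_ltW vsd; lia.
      have -> : st k (iteri k st x0) = iteri k.+1 st x0 by [].
      by rewrite /sg; regs.
    + by congr clean; rewrite /sg /=; regs.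
    + by [].
  apply: exec_seq; first by apply: exec_clear; lia.
  apply: exec_conv (exec_transfer _ _ _ _ _ _ _) erefl _; try lia.
  by congr clean; rewrite /sg; regs.
- by move=> dN vsd z; rewrite -map_drop; apply: IH => //; apply/allP => r /mem_drop/(allP vsd).
- rewrite geq_max => /andP[de d2] vsd z; apply: exec_seq (IH _ _ _ de vsd z) _.
  apply: exec_conv (exec_call d2 Mh _ _) erefl _.
  + by rewrite /upd; case: eqP => [|_]; [lia|apply: z; lia].
  + by rewrite /upd; case: eqP => [|_]; [lia|apply: z; lia].
  by congr clean; rewrite upd_eq; regs.
Qed.

End Compile.

(** A primitive recursive expression in [h] is computable from any oracle that
    computes [h]; this contains the transitivity of Turing reducibility for the
    reductions used here. *)
Lemma eval_turing_le (e : expr) (g : nat -> nat) :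
  turing_le h g -> turing_le (fun x => eval [:: x] e) g.
Proof.
move=> [M Mh]; pose N := (need e 1); pose I := ('I_N.+1 + option (tape_index M))%type.
have one_blank : rone M != rblank M.
  by apply: contra (one_neq_blank M) => /eqP[->].
apply: (@prog_turing_le _ _ _ _ (qtape M N) one_blank (compile M N e [:: 0%N] 1)
  (reg M N 0) (reg M N 1)) => x.
exists (@clean M N (upd (upd (fun=> 0%N) 0 x) 1 (eval [:: x] e))).
  apply: exec_conv (@exec_compile M N g Mh e [:: 0%N] 1 (upd (fun=> 0%N) 0 x) _ _ _) _ _ => //.
    by case.
  apply/funext => -[i|j].
    rewrite eq_reg // /clean /conf /upd.
    by case: eqP.
  rewrite inr_neq_reg; case: j => [j|]; apply/funext => -[z|z] //=.
  by case: eqP.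
by rewrite /reg /= inordK // ltnS; exact: need_ge.
Qed.

Definition econst k := iter k ESucc EZero.
Definition eadd a b := ERec a b (ESucc (EVar 1)).
Definition epred a := ERec a EZero (EVar 0).
Definition esub a b := ERec b a (epred (EVar 1)).
Definition emul a b := ERec a EZero (eadd (EVar 1) (EWk 2 b)).
Definition eexp a b := ERec b (econst 1) (emul (EVar 1) (EWk 2 a)).
(** For a nonzero [c] the step, which ignores the value reached so far, is
    repeated [c] times. *)
Definition eif c a b := ERec c b (EWk 2 a).
Definition eeq a b := eif (eadd (esub a b) (esub b a)) EZero (econst 1).
(** For [b = 0] the counter is never reset, which agrees with the convention
    [a %% 0 = a]. *)
Definition emod a b :=
  ERec a EZero (eif (eeq (ESucc (EVar 1)) (EWk 2 b)) EZero (ESucc (EVar 1))).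
(** The quotient is the number of multiples of [b] between 1 and [a]. *)
Definition ediv a b :=
  ERec a EZero (eadd (EVar 1) (eeq (emod (ESucc (EVar 0)) (EWk 2 b)) EZero)).
(** The summand sees its index as variable 0; variable 1 is the partial sum. *)
Definition esum n f := ERec n EZero (eadd (EVar 1) f).
Fixpoint eswitch (fs : seq expr) (e : expr) : expr :=
  if fs is f :: fs' then eif e (eswitch fs' (epred e)) f else EZero.

Lemma eval_succ rho e : eval rho (ESucc e) = (eval rho e).+1.
Proof. by []. Qed.

Lemma eval_const rho k : eval rho (econst k) = k.
Proof. by elim: k => //= k ->. Qed.

Lemma eval_add rho a b : eval rho (eadd a b) = (eval rho a + eval rho b)%N.
Proof. by rewrite /=; elim: (eval rho a) => //= n ->. Qed.

Lemma eval_pred rho a : eval rho (epred a) = (eval rho a).-1.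
Proof. by rewrite /=; case: (eval rho a). Qed.

Lemma eval_sub rho a b : eval rho (esub a b) = (eval rho a - eval rho b)%N.
Proof.
rewrite /esub; cbn [eval]; elim: (eval rho b) => [|n IH]; first by rewrite subn0.
by rewrite iteriS eval_pred /= IH subnS.
Qed.

Lemma eval_mul rho a b : eval rho (emul a b) = (eval rho a * eval rho b)%N.
Proof.
rewrite /emul; cbn [eval]; elim: (eval rho a) => // n IH.
by rewrite iteriS eval_add IH /= drop0 mulSn addnC.
Qed.

Lemma eval_exp rho a b : eval rho (eexp a b) = (eval rho a ^ eval rho b)%N.
Proof.
rewrite /eexp; cbn [eval]; elim: (eval rho b) => [|n IH]; first by rewrite eval_const.
by rewrite iteriS eval_mul IH /= drop0 expnS mulnC.
Qed.

Lemma eval_if rho c a b :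
  eval rho (eif c a b) = if eval rho c is 0%N then eval rho b else eval rho a.
Proof. by rewrite /=; case: (eval rho c) => //= n; rewrite drop0. Qed.

Lemma eval_eq rho a b : eval rho (eeq a b) = (eval rho a == eval rho b).
Proof.
rewrite eval_if eval_const eval_add !eval_sub.
by case: ltngtP => // ab; case E: (_ + _)%N => //; lia.
Qed.

Lemma eval_mod rho a b : eval rho (emod a b) = (eval rho a %% eval rho b)%N.
Proof.
rewrite /emod; cbn [eval]; set m := eval rho b; elim: (eval rho a) => [|n IH].
  by rewrite mod0n.
rewrite iteriS eval_if eval_eq IH /= drop0 -/m.
have [->|m0] := posnP m; first by rewrite !modn0.
have [E|E] := eqVneq (n %% m).+1 m.
  by rewrite -[in RHS](addn1 n) -modnDml addn1 E modnn.
rewrite -[in RHS](addn1 n) -modnDml addn1 (@modn_small (n %% m).+1) //.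
by rewrite ltn_neqAle E ltn_mod.
Qed.

Lemma eval_div rho a b : eval rho (ediv a b) = (eval rho a %/ eval rho b)%N.
Proof.
rewrite /ediv; cbn [eval]; set m := eval rho b; elim: (eval rho a) => [|n IH].
  by rewrite div0n.
rewrite iteriS eval_add eval_eq eval_mod IH /= drop0 -/m.
have [->|m0] := posnP m; first by rewrite !divn0 modn0.
by rewrite divnS // addnC.
Qed.

Lemma eval_sum rho n f (F : nat -> nat) :
  (forall k acc, eval [:: k, acc & rho] f = F k) ->
  eval rho (esum n f) = (\sum_(k < eval rho n) F k)%N.
Proof.
move=> fF; rewrite /esum; cbn [eval]; elim: (eval rho n) => [|m IH].
  by rewrite big_ord0.
by rewrite iteriS eval_add fF IH big_ord_recr.
Qed.

Lemma eval_switch rho fs e :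
  eval rho (eswitch fs e) = nth 0%N (map (eval rho) fs) (eval rho e).
Proof.
elim: fs e => [|f fs IH] e; first by rewrite nth_nil.
by rewrite /eswitch -/eswitch eval_if IH eval_pred; case: (eval rho e).
Qed.

End Expr.

(** * Unconditional sums of real families *)
Section RealSum.
Local Open Scope classical_set_scope.
Local Open Scope ring_scope.
Variables (R : realType) (G : groupType).
Implicit Types (f : G -> R).

Definition summ f := summable setT (EFin \o f).
(** Sums of nonnegative families, for which suprema over finite sets are
    convenient; [real_sum] reduces to a difference of two of them. *)
Definition psum f : R := fine (\esum_(x in [set: G]) (f x)%:E).

Lemma summ_fin f : (forall x, 0 <= f x) -> summ f ->
  (\esum_(x in [set: G]) (f x)%:E)%E \is a fin_num.
Proof.
move=> f0; rewrite /summ summableE; congr (is_true (_ \is a fin_num)).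
by apply: eq_esum => x _; rewrite gee0_abs ?lee_fin //= lee_fin.
Qed.

Lemma psum_fset f (F : {fset G}) : (forall x, 0 <= f x) -> summ f ->
  \sum_(x <- F) f x <= psum f.
Proof.
move=> f0 sf; rewrite -lee_fin /psum fineK ?summ_fin //.
apply: esum_ge; exists [set` F].
  by split => //; exact: finite_fset.
by rewrite fsbig_finite //= set_fsetK sumEFin.
Qed.

(** Summability in the form in which it is checked below. *)
Lemma summ_bounded f c : (forall F : {fset G}, \sum_(x <- F) `|f x| <= c) -> summ f.
Proof.
move=> fc; rewrite /summ /summable; apply: (@le_lt_trans _ _ c%:E); last exact: ltry.
apply: ge_ereal_sup => _ [X [finX _] <-].
by rewrite fsbig_finite //= sumEFin lee_fin fc.
Qed.

Lemma psum_le f c : (forall x, 0 <= f x) ->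
  (forall F : {fset G}, \sum_(x <- F) f x <= c) -> psum f <= c.
Proof.
move=> f0 fc; have sf : summ f.
  by apply: (@summ_bounded _ c) => F; under eq_bigr do rewrite ger0_norm //.
rewrite -lee_fin /psum fineK ?summ_fin //.
apply: ge_ereal_sup => _ [X [finX _] <-].
by rewrite fsbig_finite //= sumEFin lee_fin fc.
Qed.

Lemma summ_fset f (F : {fset G}) : summ f -> \sum_(x <- F) `|f x| <= psum (fun x => `|f x|).
Proof.
move=> sf; apply: psum_fset => // .
by apply: le_lt_trans sf; apply: le_esum => x _ /=; rewrite normr_id.
Qed.

Lemma summ_le f g : (forall x, `|f x| <= g x) -> summ g -> summ f.
Proof.
move=> fg sg; apply: le_lt_trans sg; apply: le_esum => x _ /=.
by rewrite lee_fin (le_trans (fg x)) // ler_norm.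
Qed.

Lemma summD f g : summ f -> summ g -> summ (fun x => f x + g x).
Proof. exact: summableD. Qed.

Lemma summN f : summ f -> summ (fun x => - f x).
Proof. by rewrite /summ summableN. Qed.

Lemma summZ c f : summ f -> summ (fun x => c * f x).
Proof.
move=> sf; apply: (@summ_bounded _ (`|c| * psum (fun x => `|f x|))) => F.
under eq_bigr do rewrite normrM; rewrite -mulr_sumr.
by apply: ler_wpM2l => //; apply: summ_fset.
Qed.

Lemma psumD f g : (forall x, 0 <= f x) -> (forall x, 0 <= g x) -> summ f -> summ g ->
  psum (fun x => f x + g x) = psum f + psum g.
Proof.
move=> f0 g0 sf sg; rewrite /psum.
under eq_esum do rewrite EFinD.
rewrite esumD //; try by move=> x _; rewrite lee_fin.
by rewrite fineD // summ_fin.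
Qed.

Lemma psumZ c f : 0 <= c -> (forall x, 0 <= f x) -> summ f ->
  psum (fun x => c * f x) = c * psum f.
Proof.
move=> c0 f0 sf; have [->|cn0] := eqVneq c 0.
  rewrite mul0r /psum esum1 //= => x _; by rewrite mul0r.
apply/eqP; rewrite eq_le; apply/andP; split.
  apply: psum_le => [x|F]; first exact: mulr_ge0.
  by rewrite -mulr_sumr ler_wpM2l // psum_fset.
rewrite mulrC -ler_pdivlMr ?lt0r ?cn0 //.
apply: psum_le => // F; rewrite ler_pdivlMr ?lt0r ?cn0 // mulrC mulr_sumr.
by apply: psum_fset; [move=> x; exact: mulr_ge0|exact: summZ].
Qed.

(** Any decomposition into nonnegative summable families computes the sum, not
    only the one into positive and negative parts; additivity follows. *)
Lemma real_sum_psumB f g : (forall x, 0 <= f x) -> (forall x, 0 <= g x) ->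
  summ f -> summ g -> real_sum (fun x => f x - g x) = psum f - psum g.
Proof.
move=> f0 g0 sf sg; rewrite /real_sum.
have -> : EFin \o (fun x => f x - g x) = ((EFin \o f) \- (EFin \o g))%E by [].
rewrite (esumB sf sg) /psum; try by move=> x _; rewrite lee_fin.
by rewrite fineB //= summ_fin.
Qed.

Lemma real_sum_psum f : (forall x, 0 <= f x) -> summ f -> real_sum f = psum f.
Proof.
move=> f0 sf; have s0 : summ (fun=> 0).
  by apply: (@summ_bounded _ 0) => F; rewrite big1 // => x _; rewrite normr0.
have -> : f = (fun x => f x - (fun=> 0) x) by apply/funext => x; rewrite subr0.
rewrite real_sum_psumB // [X in _ - X](_ : _ = 0) ?subr0; last by rewrite /psum esum1.
by congr psum; apply/funext => x; rewrite subr0.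
Qed.

Definition pos_part f x := Num.max (f x) 0.
Definition neg_part f x := Num.max (- f x) 0.

Lemma pos_part_ge0 f x : 0 <= pos_part f x.
Proof. by rewrite le_max lexx orbT. Qed.
Lemma neg_part_ge0 f x : 0 <= neg_part f x.
Proof. by rewrite le_max lexx orbT. Qed.
Lemma pos_neg_part f x : f x = pos_part f x - neg_part f x.
Proof. by rewrite /pos_part /neg_part; case: (leP (f x) 0); case: (leP (- f x) 0); lra. Qed.
Lemma summ_pos f : summ f -> summ (pos_part f).
Proof.
move=> sf; apply: (@summ_le _ (fun x => `|f x|)).
  by move=> x; rewrite ger0_norm ?pos_part_ge0 // ge_max ler_norm normr_ge0.
by apply: le_lt_trans sf; apply: le_esum => x _ /=; rewrite normr_id.
Qed.
Lemma summ_neg f : summ f -> summ (neg_part f).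
Proof. by move=> /summN /summ_pos. Qed.

Lemma real_sumE f : summ f -> real_sum f = psum (pos_part f) - psum (neg_part f).
Proof.
move=> sf; rewrite -real_sum_psumB; [|exact: pos_part_ge0|exact: neg_part_ge0|
  exact: summ_pos|exact: summ_neg].
by congr real_sum; apply/funext => x; exact: pos_neg_part.
Qed.

Lemma real_sumD f g : summ f -> summ g ->
  real_sum (fun x => f x + g x) = real_sum f + real_sum g.
Proof.
move=> sf sg; pose a x := pos_part f x + pos_part g x; pose b x := neg_part f x + neg_part g x.
have -> : (fun x => f x + g x) = (fun x => a x - b x).
  by apply/funext => x; rewrite {1}(pos_neg_part f x) {1}(pos_neg_part g x) /a /b; ring.
have [p n] := (pos_part_ge0, neg_part_ge0).
have sfp := summ_pos sf; have sgp := summ_pos sg.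
have sfn := summ_neg sf; have sgn := summ_neg sg.
rewrite real_sum_psumB ?psumD ?real_sumE //; first ring.
- by move=> x; apply: addr_ge0.
- by move=> x; apply: addr_ge0.
- exact: summD.
- exact: summD.
Qed.

Lemma real_sumN f : summ f -> real_sum (fun x => - f x) = - real_sum f.
Proof.
move=> sf; rewrite !real_sumE //; last exact: summN.
rewrite opprB; congr (_ - _).
by congr psum; apply/funext => x; rewrite /neg_part opprK.
Qed.

Lemma real_sumZ c f : summ f -> real_sum (fun x => c * f x) = c * real_sum f.
Proof.
wlog c0 : c f / 0 <= c => [H sf|sf].
  have [c0|/ltW c0] := leP 0 c; first exact: H.
  have -> : (fun x => c * f x) = (fun x => - c * - f x) by apply/funext => x; ring.
  by rewrite H ?oppr_ge0 // ?real_sumN ?mulrNN //; exact: summN.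
have -> : (fun x => c * f x) = (fun x => c * pos_part f x - c * neg_part f x).
  by apply/funext => x; rewrite -mulrBr -pos_neg_part.
have [p n] := (pos_part_ge0, neg_part_ge0).
have sfp := summ_pos sf; have sfn := summ_neg sf.
rewrite real_sum_psumB ?psumZ ?real_sumE ?mulrBr // => *; try exact: mulr_ge0.
- exact: summZ.
- exact: summZ.
Qed.

Lemma summ0 : summ (fun _ : G => 0).
Proof. by apply: (@summ_bounded _ 0) => F; rewrite big1 // normr0. Qed.

Lemma real_sum0 : real_sum (fun _ : G => 0) = 0 :> R.
Proof.
rewrite (_ : (fun=> 0) = (fun x : G => 0 * (0 : R))); last by apply/funext => x; rewrite mul0r.
by rewrite real_sumZ ?mul0r //; exact: summ0.
Qed.

Lemma translate_bij (h : G) : set_bij [set: G] [set: G] (fun x => (x * h)%g).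
Proof.
split=> // [x y _ _ /mulIg //|x _]; exists (x * h^-1)%g => //.
by rewrite -mulgA mulVg mulg1.
Qed.

Lemma real_sum_translate f h : real_sum (fun x => f (x * h)%g) = real_sum f.
Proof.
rewrite /real_sum; congr (fine (_ - _)%E);
  rewrite [RHS](@reindex_esum _ _ _ [set: G] [set: G] _ _ (translate_bij h));
  by apply: eq_esum => x _; rewrite unlock.
Qed.

Lemma summ_translate f h : summ f -> summ (fun x => f (x * h)%g).
Proof. by rewrite /summ /summable (@reindex_esum _ _ _ [set: G] [set: G] _ _ (translate_bij h)). Qed.

Lemma summ_point (c : R) (x0 : G) : summ (fun x => if x == x0 then c else 0).
Proof.
apply: (@summ_bounded _ `|c|) => F.
have [xF|xF] := boolP (x0 \in F).
  rewrite (big_fsetD1 x0) //= eqxx big1_fset ?addr0 // => x.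
  by rewrite !inE => /andP[/negbTE -> _]; rewrite normr0.
rewrite big1_seq // => x /= Fx; case: eqP => [xx|_]; last by rewrite normr0.
by rewrite -xx Fx in xF.
Qed.

Lemma real_sum_point (c : R) (x0 : G) : real_sum (fun x => if x == x0 then c else 0) = c.
Proof.
have -> : (fun x => if x == x0 then c else 0) = (fun x => c * (x == x0)%:R).
  by apply/funext => x; case: eqP; rewrite ?mulr1 ?mulr0.
have s1 : summ (fun x => (x == x0)%:R).
  have -> : (fun x => (x == x0)%:R) = (fun x => if x == x0 then 1 else 0 : R).
    by apply/funext => x; case: eqP.
  exact: summ_point.
rewrite real_sumZ // real_sum_psum // /psum (esumID [set x0]) ?setTI; last first.
  by move=> x _; rewrite lee_fin.
rewrite esum_set1 ?eqxx ?lee_fin // esum1 ?adde0 ?mulr1 // => x /= xx0.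
by case: eqP.
Qed.

Lemma real_sum_ge0 f : (forall x, 0 <= f x) -> summ f -> 0 <= real_sum f.
Proof.
move=> f0 sf; rewrite real_sum_psum //.
by have := psum_fset fset0 f0 sf; rewrite big_seq_fset0.
Qed.

End RealSum.

(** * Square summable real vectors *)
Section RealVectors.
Variables (R : realType) (G : groupType).

Definition sql2 (I : finType) (u : I -> G -> R) :=
  forall i, summ (fun g => u i g ^+ 2).

Definition dot (I : finType) (u v : I -> G -> R) : R :=
  \sum_(i : I) real_sum (fun g => u i g * v i g).

Lemma summ_mul (f g : G -> R) : summ (fun x => f x ^+ 2) -> summ (fun x => g x ^+ 2) ->
  summ (fun x => f x * g x).
Proof.
move=> sf sg; apply: (@summ_le _ _ _ (fun x => f x ^+ 2 + g x ^+ 2)); last exact: summD.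
by move=> x; rewrite ler_norml; apply/andP; split; nra.
Qed.

Section Dot.
Variable I : finType.
Implicit Types u v w : I -> G -> R.

(** Binary linear combinations are the only vector operations used, so the
    closure and expansion lemmas are stated for them. *)
Lemma sql2_lin a b u v : sql2 u -> sql2 v -> sql2 (fun i g => a * u i g + b * v i g).
Proof.
move=> su sv i.
have -> : (fun g => (a * u i g + b * v i g) ^+ 2) =
  (fun g => a ^+ 2 * u i g ^+ 2 + (2 * a * b) * (u i g * v i g) + b ^+ 2 * v i g ^+ 2).
  by apply/funext => g; ring.
by apply: summD; [apply: summD|]; apply: summZ => //; apply: summ_mul.
Qed.

(** Lets the supremum over finite sets be taken for all coordinates at once. *)
Lemma psum_sum (f : I -> G -> R) : (forall i g, 0 <= f i g) -> (forall i, summ (f i)) ->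
  psum (fun g => \sum_i f i g) = \sum_i psum (f i).
Proof.
move=> f0 sf; elim: (index_enum I) => [|i s IH].
  rewrite big_nil -[RHS](@real_sum0 R G) real_sum_psum //; last exact: summ0.
  by congr psum; apply/funext => g; rewrite big_nil.
rewrite big_cons -IH -psumD //.
- by congr psum; apply/funext => g; rewrite big_cons.
- by move=> g; apply: sumr_ge0.
- elim: s {IH} => [|j s IH].
    rewrite (_ : (fun g => _) = fun=> 0); first exact: summ0.
    by apply/funext => g; rewrite big_nil.
  rewrite (_ : (fun g => _) = fun g => f j g + \sum_(k <- s) f k g); first exact: summD.
  by apply/funext => g; rewrite big_cons.
Qed.

Lemma dotC u v : dot u v = dot v u.
Proof.
by apply: eq_bigr => i _; congr real_sum; apply/funext => g; rewrite mulrC.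
Qed.

Lemma dot_linl a b u v w : sql2 u -> sql2 v -> sql2 w ->
  dot (fun i g => a * u i g + b * v i g) w = a * dot u w + b * dot v w.
Proof.
move=> su sv sw; rewrite /dot !mulr_sumr -big_split; apply: eq_bigr => i _ /=.
have suw := summ_mul (su i) (sw i); have svw := summ_mul (sv i) (sw i).
rewrite -!real_sumZ // -real_sumD; [|exact: summZ..].
by congr real_sum; apply/funext => g; ring.
Qed.

Lemma dot_linr a b u v w : sql2 u -> sql2 v -> sql2 w ->
  dot w (fun i g => a * u i g + b * v i g) = a * dot w u + b * dot w v.
Proof. by move=> *; rewrite dotC dot_linl // !(dotC w). Qed.

Lemma dot_sq_lin a b u v : sql2 u -> sql2 v ->
  dot (fun i g => a * u i g + b * v i g) (fun i g => a * u i g + b * v i g) =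
  a ^+ 2 * dot u u + 2 * a * b * dot u v + b ^+ 2 * dot v v.
Proof.
move=> su sv; have s := sql2_lin a b su sv.
by rewrite dot_linl // !dot_linr // (dotC v u); ring.
Qed.

Lemma dot_ge0 u : sql2 u -> 0 <= dot u u.
Proof.
move=> su; apply: sumr_ge0 => i _; apply: real_sum_ge0 => [g|]; first by nra.
by apply: summ_mul.
Qed.

Lemma dot_psum u : sql2 u -> dot u u = \sum_i psum (fun g => u i g ^+ 2).
Proof.
move=> su; apply: eq_bigr => i _.
by rewrite real_sum_psum //; [move=> g; nra|exact: summ_mul].
Qed.

Lemma dot_ge_fset u (F : {fset G}) : sql2 u ->
  \sum_i \sum_(g <- F) u i g ^+ 2 <= dot u u.
Proof.
move=> su; rewrite dot_psum //; apply: ler_sum => i _.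
by apply: psum_fset => // g; exact: sqr_ge0.
Qed.

Lemma dot_ge_coord u i g : sql2 u -> u i g ^+ 2 <= dot u u.
Proof.
move=> su; apply: le_trans (dot_ge_fset [fset g]%fset su).
rewrite (bigD1 i) //= big_seq_fset1 lerDl; apply: sumr_ge0 => j _.
by apply: sumr_ge0 => h _; exact: sqr_ge0.
Qed.

(** Fatou's lemma in the form needed for pointwise limits: a uniform bound on
    finite partial sums bounds the norm. *)
Lemma dot_le_fset u c : (forall F : {fset G}, \sum_i \sum_(g <- F) u i g ^+ 2 <= c) ->
  sql2 u /\ dot u u <= c.
Proof.
move=> uc; have su : sql2 u.
  move=> i; apply: (@summ_bounded _ _ _ c) => F; apply: le_trans (uc F).
  rewrite (bigD1 i) //= ler_wpDr //.
    by apply: sumr_ge0 => j _; apply: sumr_ge0 => h _; exact: sqr_ge0.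
  by apply: ler_sum => g _; rewrite ger0_norm // sqr_ge0.
split=> //; rewrite dot_psum // -psum_sum //; last by move=> i g; exact: sqr_ge0.
apply: psum_le => [g|F]; first by apply: sumr_ge0 => i _; exact: sqr_ge0.
by rewrite exchange_big; exact: uc.
Qed.

End Dot.
End RealVectors.

(** * Signed translations *)

(** A term of a matrix entry: plus or minus a group element [ashift], in row
    [asrc] and column [atgt].  Integer coefficients become repetitions, so that
    the matrix operators are plain sums over lists, both over the reals and
    over the integers, and traces become differences of two cardinalities. *)
Record atom (G I J : Type) :=
  Atom { asrc : I; atgt : J; aneg : bool; ashift : G }.

Section Operators.
Variables (G : groupType).

Section Def.
Variables (V : pzRingType) (I J : finType).

Definition op1 (l : atom G I J) (u : I -> G -> V) : J -> G -> V := fun j g =>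
  if atgt l == j then (-1) ^+ aneg l * u (asrc l) (g * (ashift l)^-1)%g else 0.

Definition op (L : seq (atom G I J)) (u : I -> G -> V) : J -> G -> V := fun j g =>
  \sum_(l <- L) op1 l u j g.

End Def.

Definition adj1 (I J : finType) (l : atom G I J) : atom G J I :=
  Atom (atgt l) (asrc l) (aneg l) (ashift l)^-1%g.
Definition adj (I J : finType) (L : seq (atom G I J)) := map (@adj1 I J) L.

Variable R : realType.
Section Real.
Variables (I J : finType).
Implicit Types (u : I -> G -> R) (v : J -> G -> R) (l : atom G I J) (L : seq (atom G I J)).

Lemma op_nil u : op ([::] : seq (atom G I J)) u = fun (_ : J) _ => 0.
Proof. by apply/funext => j; apply/funext => g; rewrite /op big_nil. Qed.

Lemma op_cons l L u : op (l :: L) u = fun j g => 1 * op1 l u j g + 1 * op L u j g.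
Proof. by apply/funext => j; apply/funext => g; rewrite /op big_cons !mul1r. Qed.

Lemma sql2_0 (K : finType) : sql2 (fun (_ : K) (_ : G) => 0 : R).
Proof. by move=> i; rewrite expr0n; exact: summ0. Qed.

Lemma sql2_op1 l u : sql2 u -> sql2 (op1 l u).
Proof.
move=> su j; rewrite /op1; case: eqP => _; last by rewrite expr0n; exact: summ0.
rewrite (_ : (fun g => _) = fun g => u (asrc l) (g * (ashift l)^-1)%g ^+ 2).
  exact: (@summ_translate R G (fun h => u (asrc l) h ^+ 2)).
by apply/funext => g; rewrite exprMn sqrr_sign mul1r.
Qed.

Lemma sql2_op L u : sql2 u -> sql2 (op L u).
Proof.
move=> su; elim: L => [|l L IH]; first by rewrite op_nil; exact: sql2_0.
by rewrite op_cons; apply: sql2_lin => //; exact: sql2_op1.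
Qed.

End Real.

Section Dot.
Variables (I J : finType).
Implicit Types (u : I -> G -> R) (v : J -> G -> R) (l : atom G I J) (L : seq (atom G I J)).

Lemma dot0l (K : finType) (w : K -> G -> R) : dot (fun _ _ => 0) w = 0.
Proof.
rewrite /dot big1 // => i _; rewrite -[RHS](@real_sum0 R G).
by congr real_sum; apply/funext => g; rewrite mul0r.
Qed.

(** Translations are unitary: substitute [g * ashift l] for [g]. *)
Lemma dot_op1 l u v : sql2 u -> sql2 v -> dot (op1 l u) v = dot u (op1 (adj1 l) v).
Proof.
move=> su sv; rewrite /dot (bigD1 (atgt l)) //= [X in _ + X]big1 ?addr0; last first.
  move=> j /negbTE jl; rewrite -[RHS](@real_sum0 R G).
  by congr real_sum; apply/funext => g; rewrite /op1 eq_sym jl mul0r.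
rewrite [RHS](bigD1 (asrc l)) //= [X in _ = _ + X]big1 ?addr0; last first.
  move=> j /negbTE jl; rewrite -[RHS](@real_sum0 R G).
  by congr real_sum; apply/funext => g; rewrite /op1 /= eq_sym jl mulr0.
rewrite -(real_sum_translate _ (ashift l)); congr real_sum; apply/funext => g.
by rewrite /op1 /= !eqxx invgK mulgK mulrCA mulrA.
Qed.

Lemma dot_op L u v : sql2 u -> sql2 v -> dot (op L u) v = dot u (op (adj L) v).
Proof.
move=> su sv; elim: L => [|l L IH].
  by rewrite [adj _]/= !op_nil dot0l dotC dot0l.
rewrite op_cons [adj _]/= op_cons dot_linl //; [|exact: sql2_op1|exact: sql2_op].
by rewrite dot_linr // ?IH ?dot_op1 //; [exact: sql2_op1|exact: sql2_op].
Qed.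

Lemma dot_op1_le l u : sql2 u -> dot (op1 l u) (op1 l u) <= dot u u.
Proof.
move=> su; rewrite /dot (bigD1 (atgt l)) //= [X in _ + X]big1 ?addr0; last first.
  move=> j /negbTE jl; rewrite -[RHS](@real_sum0 R G).
  by congr real_sum; apply/funext => g; rewrite /op1 eq_sym jl mul0r.
rewrite (_ : real_sum _ = real_sum (fun g => u (asrc l) g * u (asrc l) g)).
  rewrite (bigD1 (asrc l)) //= lerDl; apply: sumr_ge0 => i _.
  by apply: real_sum_ge0 => [g|]; [nra|exact: summ_mul].
rewrite -[RHS](real_sum_translate _ (ashift l)^-1%g); congr real_sum; apply/funext => g.
by rewrite /op1 eqxx mulrACA -expr2 sqrr_sign mul1r.
Qed.

(** A bound for the square of the norm of an operator with [n] terms.  The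
    inequality [|u + v|^2 <= 2 |u|^2 + 2 |v|^2] gives the recursion
    [x |-> 2 x + 2], solved by [2 ^ n.+1 - 2]; adding 2 makes the bound at
    least 2 also for [n = 0]. *)
Definition op_bound (n : nat) : nat := 2 ^ n.+1.

Lemma dot_op_le L u : sql2 u -> dot (op L u) (op L u) <= (op_bound (size L))%:R * dot u u.
Proof.
move=> su; have u0 := dot_ge0 su.
suff : dot (op L u) (op L u) <= (op_bound (size L) - 2)%:R * dot u u.
  move=> /le_trans -> //; apply: ler_wpM2r => //; rewrite ler_nat; exact: leq_subr.
elim: L => [|l L IH]; first by rewrite op_nil dot0l subnn mul0r.
have s1 := sql2_op1 l su; have s2 := sql2_op L su.
have sq0 : 0 <= dot (fun i g => 1 * op1 l u i g + (-1) * op L u i g)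
                    (fun i g => 1 * op1 l u i g + (-1) * op L u i g).
  by apply: dot_ge0; exact: sql2_lin.
have le1 := dot_op1_le l su.
have -> : (op_bound (size (l :: L)) - 2 = 2 + 2 * (op_bound (size L) - 2))%N.
  rewrite /op_bound /= expnS; have : (0 < 2 ^ (size L))%N by rewrite expn_gt0.
  by rewrite expnS; lia.
rewrite op_cons; move: sq0; rewrite !dot_sq_lin // natrD natrM.
by move=> sq0; nra.
Qed.

End Dot.

End Operators.

(** * The heat semigroup and its limit *)
Section Limits.
Local Open Scope classical_set_scope.
Local Open Scope ring_scope.
Variables (R : realType).

(** Cauchy's criterion in the form in which the parallelogram identity gives
    it. *)
Lemma cvg_of_sq_le (x dl : nat -> R) : dl p @[p --> \oo] --> 0 ->
  (forall p q, (x p - x q) ^+ 2 <= dl p + dl q) -> cvgn x.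
Proof.
move=> dl0 xdl; apply/cauchy_cvgP; apply: cauchy_exP => e e0.
have e2 : 0 < e ^+ 2 / 2 by rewrite divr_gt0 // exprn_gt0.
have /cvgrPdist_lt/(_ _ e2)[N _ HN] := dl0; exists (x N).
exists N => // q /= Nq; have hN := HN N (leqnn N); have hq := HN q Nq.
rewrite -ball_normE /=.
rewrite -(@ltr_pXn2r _ 2) ?nnegrE ?normr_ge0 ?ltW // real_normK ?num_real //.
apply: le_lt_trans (xdl N q) _; move: hN hq; rewrite /= !sub0r !normrN.
by move=> /(le_lt_trans (ler_norm _)) a /(le_lt_trans (ler_norm _)) b; lra.
Qed.

Lemma cvg_sumr (T : Type) (s : seq T) (f : T -> nat -> R) (l : T -> R) :
  (forall t, f t p @[p --> \oo] --> l t) ->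
  (\sum_(t <- s) f t p) @[p --> \oo] --> \sum_(t <- s) l t.
Proof. by move=> fl; apply: cvg_big => //; exact: add_continuous. Qed.

Lemma cvg_sqr (x : nat -> R) (l : R) : x p @[p --> \oo] --> l -> x p ^+ 2 @[p --> \oo] --> l ^+ 2.
Proof. by move=> xl; rewrite expr2; under eq_fun do rewrite expr2; exact: cvgM. Qed.

End Limits.

Section Heat.
Local Open Scope classical_set_scope.
Local Open Scope ring_scope.
Variables (R : realType) (G : groupType) (I J : finType) (L : seq (atom G I J)).
Implicit Types u v w z : I -> G -> R.

Local Notation K := ((op_bound (size L))%:R : R).

Lemma op_bound_gt0 : 0 < K.
Proof. by rewrite ltr0n expn_gt0. Qed.

(** As [K] bounds the square of the norm of [op L], the operator
    [heat = 1 - K^-1 laplace] is a self-adjoint contraction that fixes exactly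
    the kernel of [op L]. *)
Definition laplace u := op (adj L) (op L u).
Definition heat u : I -> G -> R := fun i g => 1 * u i g + (- K^-1) * laplace u i g.

Lemma sql2_laplace u : sql2 u -> sql2 (laplace u).
Proof. by move=> su; do 2!apply: sql2_op. Qed.

Lemma sql2_heat u : sql2 u -> sql2 (heat u).
Proof. by move=> su; apply: sql2_lin => //; exact: sql2_laplace. Qed.

Lemma dot_laplace u v : sql2 u -> sql2 v -> dot (laplace u) v = dot (op L u) (op L v).
Proof. by move=> su sv; rewrite dotC -dot_op ?(dotC (op L v)) //; exact: sql2_op. Qed.

Lemma dot_heat u v : sql2 u -> sql2 v -> dot (heat u) v = dot u (heat v).
Proof.
move=> su sv; have [lu lv] := (sql2_laplace su, sql2_laplace sv).
rewrite dot_linl // dot_linr // dot_laplace // (dotC u (laplace v)) dot_laplace //.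
by rewrite (dotC (op L v)).
Qed.

(** Contraction with the exact loss that is needed later: it controls
    [op L u], so that limits of heat powers lie in the kernel. *)
Lemma dot_heat_le u : sql2 u ->
  dot (heat u) (heat u) <= dot u u - K^-1 * dot (op L u) (op L u).
Proof.
move=> su; have lu := sql2_laplace su; have su' := sql2_op L su.
rewrite dot_sq_lin // (dotC u) dot_laplace //.
have := dot_op_le (adj L) su'; rewrite size_map -/(laplace u) => le.
have k0 : 0 < K^-1 by rewrite invr_gt0 op_bound_gt0.
have : K^-1 ^+ 2 * dot (laplace u) (laplace u) <= K^-1 * dot (op L u) (op L u).
  rewrite expr2 -mulrA; apply: ler_wpM2l; first exact: ltW.
  by rewrite mulrC ler_pdivrMr ?op_bound_gt0 // mulrC.
by rewrite sqrrN expr1n; lra.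
Qed.

Lemma heat_ker z : (forall j g, op L z j g = 0) -> heat z = z.
Proof.
move=> z0; apply/funext => i; apply/funext => g; rewrite /heat /laplace.
rewrite (_ : op L z = fun=> fun=> 0); last by do 2!apply/funext => ?.
by rewrite /op big1 ?mulr0 ?addr0 ?mul1r // => l _; rewrite /op1 mulr0 if_same.
Qed.

Lemma iter_heat_ker z p : (forall j g, op L z j g = 0) -> iter p heat z = z.
Proof. by move=> z0; elim: p => //= p ->; exact: heat_ker. Qed.

Lemma sql2_iter_heat p u : sql2 u -> sql2 (iter p heat u).
Proof. by move=> su; elim: p => //= p; exact: sql2_heat. Qed.

Lemma dot_iter_heat p u v : sql2 u -> sql2 v ->
  dot (iter p heat u) v = dot u (iter p heat v).
Proof.
move=> su sv; elim: p v sv => // p IH v sv.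
by rewrite iterS dot_heat ?IH ?iterSr //; [exact: sql2_heat|exact: sql2_iter_heat].
Qed.

Variable i0 : I.
Definition delta : I -> G -> R := fun i g => if g == 1%g then (i == i0)%:R else 0.

Lemma sql2_delta : sql2 delta.
Proof.
move=> i; rewrite (_ : (fun g => _) = fun g => if g == 1%g then (i == i0)%:R else 0).
  exact: summ_point.
by apply/funext => g; rewrite /delta; case: (g == _); case: (i == _); rewrite ?expr1n ?expr0n.
Qed.

Lemma dot_delta v : dot delta v = v i0 1%g.
Proof.
rewrite /dot (bigD1 i0) //= big1 ?addr0 => [|i /negbTE ii0].
  rewrite (_ : (fun g => _) = fun g => if g == 1%g then v i0 1%g else 0).
    exact: real_sum_point.
  by apply/funext => g; rewrite /delta eqxx; case: eqP => [->|]; rewrite ?mul1r ?mul0r.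
rewrite -[RHS](@real_sum0 R G); congr real_sum; apply/funext => g.
by rewrite /delta ii0 if_same mul0r.
Qed.

Definition heat_at p := iter p heat delta.
(** The even heat powers have diagonal coefficients that are squared norms, so
    that they are nonnegative and decrease. *)
Definition moment p : R := heat_at p.*2 i0 1%g.

Lemma sql2_heat_at p : sql2 (heat_at p).
Proof. exact/sql2_iter_heat/sql2_delta. Qed.

Lemma dot_heat_at p q : dot (heat_at p) (heat_at q) = heat_at (p + q) i0 1%g.
Proof.
by rewrite dot_iter_heat ?dot_delta -?iterD //; [exact: sql2_delta|exact: sql2_heat_at].
Qed.

Lemma moment_dot p : moment p = dot (heat_at p) (heat_at p).
Proof. by rewrite dot_heat_at addnn. Qed.

Lemma moment_ge0 p : 0 <= moment p.
Proof. by rewrite moment_dot; apply: dot_ge0; exact: sql2_heat_at. Qed.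

Lemma moment_step p :
  moment p.+1 <= moment p - K^-1 * dot (op L (heat_at p)) (op L (heat_at p)).
Proof. by rewrite !moment_dot; exact/dot_heat_le/sql2_heat_at. Qed.

Lemma dot_op_heat_at p :
  dot (op L (heat_at p)) (op L (heat_at p)) <= K * (moment p - moment p.+1).
Proof. by rewrite mulrC -ler_pdivrMr ?op_bound_gt0 // mulrC; have := moment_step p; lra. Qed.

Lemma moment_decr : {homo moment : p q / (p <= q)%N >-> q <= p}.
Proof.
apply: homo_leq => //; first by move=> x y z yx zy; exact: le_trans zy yx.
move=> p; apply: le_trans (moment_step p) _; rewrite gerBl mulr_ge0 //.
by apply: dot_ge0; exact/sql2_op/sql2_heat_at.
Qed.

Lemma moment_cvg : cvgn moment.
Proof.
apply: nonincreasing_is_cvgn; first exact: moment_decr.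
by exists 0 => _ [p _ <-]; exact: moment_ge0.
Qed.

Definition lambda : R := limn moment.

Lemma moment_ge p : lambda <= moment p.
Proof. exact: (nonincreasing_cvgn_ge moment_decr moment_cvg). Qed.

Definition gap p := moment p - lambda.

Lemma gap_cvg : gap p @[p --> \oo] --> (0 : R).
Proof. by rewrite -(subrr lambda); apply: cvgB; [exact: moment_cvg|exact: cvg_cst]. Qed.

(** The expansion of the square has the middle term [moment (p + q)], which is
    at least the limit: the sequence of vectors is Cauchy. *)
Lemma heat_at_dist p q :
  dot (fun i g => 1 * heat_at p.*2 i g + (-1) * heat_at q.*2 i g)
      (fun i g => 1 * heat_at p.*2 i g + (-1) * heat_at q.*2 i g) <= gap p + gap q.
Proof.
have [sp sq] := (sql2_heat_at p.*2, sql2_heat_at q.*2).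
rewrite dot_sq_lin // -!moment_dot dot_heat_at -doubleD -/(moment _) /gap.
have := moment_ge (p + q).
have : moment p.*2 <= moment p by apply: moment_decr; rewrite -addnn leq_addr.
have : moment q.*2 <= moment q by apply: moment_decr; rewrite -addnn leq_addr.
lra.
Qed.

Definition heat_lim : I -> G -> R := fun i g => lim (heat_at p.*2 i g @[p --> \oo]).

Lemma heat_lim_cvg i g : heat_at p.*2 i g @[p --> \oo] --> heat_lim i g.
Proof.
apply: (cvg_of_sq_le gap_cvg) => p q; apply: le_trans (heat_at_dist p q).
set w := (X in dot X X).
have -> : heat_at p.*2 i g - heat_at q.*2 i g = w i g by rewrite /w; ring.
by apply: dot_ge_coord; apply: sql2_lin; exact: sql2_heat_at.
Qed.

Lemma heat_lim_dist p :
  let w i g := 1 * heat_lim i g + (-1) * heat_at p.*2 i g in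
  sql2 w /\ dot w w <= gap p.
Proof.
move=> w; apply: dot_le_fset => F.
have wq : (\sum_i \sum_(g <- F) (1 * heat_at q.*2 i g + (-1) * heat_at p.*2 i g) ^+ 2)
    @[q --> \oo] --> \sum_i \sum_(g <- F) w i g ^+ 2.
  apply: cvg_sumr => i; apply: cvg_sumr => g; apply: cvg_sqr.
  by apply: cvgD; [apply: cvgMr; exact: heat_lim_cvg|exact: cvg_cst].
have gq : gap q + gap p @[q --> \oo] --> gap p.
  by rewrite -[X in _ --> X]add0r; apply: cvgD; [exact: gap_cvg|exact: cvg_cst].
apply: (ler_cvg_to wq gq); apply: nearW => q.
apply: le_trans (heat_at_dist q p); apply: dot_ge_fset.
by apply: sql2_lin; exact: sql2_heat_at.
Qed.

Lemma sql2_heat_lim : sql2 heat_lim.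
Proof.
have [sw _] := heat_lim_dist 0.
rewrite (_ : heat_lim = fun i g =>
  1 * (1 * heat_lim i g + (-1) * heat_at 0.*2 i g) + 1 * heat_at 0.*2 i g).
  by apply: sql2_lin => //; exact: sql2_heat_at.
by apply/funext => i; apply/funext => g; ring.
Qed.

(** The value of [op L] at a point involves finitely many coordinates, so it
    passes to the pointwise limit, and [dot_op_heat_at] makes it vanish. *)
Lemma heat_lim_ker j g : op L heat_lim j g = 0.
Proof.
have cv : op L (heat_at p.*2) j g @[p --> \oo] --> op L heat_lim j g.
  apply: cvg_sumr => l; rewrite /op1; case: eqP => _; last exact: cvg_cst.
  by apply: cvgMr; exact: heat_lim_cvg.
have gK : K * gap p @[p --> \oo] --> (0 : R).
  by rewrite -[X in _ --> X](mulr0 K); apply: cvgMr; exact: gap_cvg.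
have : op L heat_lim j g ^+ 2 <= 0.
  apply: (ler_cvg_to (cvg_sqr cv) gK); apply: nearW => p.
  apply: le_trans (dot_ge_coord j g (sql2_op L (sql2_heat_at p.*2))) _.
  apply: le_trans (dot_op_heat_at _) _; rewrite ler_pM2l ?op_bound_gt0 //.
  apply: lerB; last exact: moment_ge.
  by apply: moment_decr; rewrite -addnn leq_addr.
by move=> le0; apply/eqP; rewrite -sqrf_eq0 eq_le le0 sqr_ge0.
Qed.

(** [z] in the kernel is fixed by the self-adjoint heat operator, so its product
    with [heat_at p] does not depend on [p].  The difference [k] with the
    product at the limit is small by the Cauchy-Schwarz inequality, here in the
    form [k ^ 2 <= (c + 1) |w| ^ 2], where [c + 1] can be divided by. *)
Lemma heat_lim_orth z : sql2 z -> (forall j g, op L z j g = 0) ->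
  dot delta z = dot heat_lim z.
Proof.
move=> sz z0.
pose k := dot heat_lim z - dot delta z; pose c := dot z z.
have c0 : 0 <= c := dot_ge0 sz.
have kP p : k ^+ 2 <= (c + 1) * gap p.
  have [sw wle] := heat_lim_dist p; set w := (fun i g => _) in sw wle.
  have kE : k = dot w z.
    rewrite /k dot_linl //; [|exact: sql2_heat_lim|exact: sql2_heat_at].
    by rewrite dot_iter_heat ?iter_heat_ker //; [ring|exact: sql2_delta].
  have c1 : 0 < c + 1 by lra.
  pose a := k / (c + 1); have ka : k = a * (c + 1) by rewrite /a mulfVK // lt0r_neq0.
  have : 0 <= dot (fun i g => 1 * w i g + (- a) * z i g) (fun i g => 1 * w i g + (- a) * z i g).
    by apply: dot_ge0; apply: sql2_lin.
  rewrite dot_sq_lin // -kE -/c => sq.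
  have : a ^+ 2 * (c + 1) <= gap p by move: sq wle; rewrite ka; nra.
  move=> /(ler_wpM2l (ltW c1)); rewrite ka; apply: le_trans; rewrite le_eqVlt.
  by apply/orP; left; apply/eqP; ring.
have cg : (c + 1) * gap p @[p --> \oo] --> (0 : R).
  by rewrite -[X in _ --> X](mulr0 (c + 1)); apply: cvgMr; exact: gap_cvg.
have : k ^+ 2 <= 0.
  have ck : k ^+ 2 @[p --> \oo] --> k ^+ 2 by exact: cvg_cst.
  exact: (ler_cvg_to ck cg (nearW _ kP)).
move=> le0; apply/eqP; rewrite eq_sym -subr_eq0 -/k -sqrf_eq0 eq_le le0; exact: sqr_ge0.
Qed.

End Heat.

(** * From real to complex vectors *)
Section Complex.
Local Open Scope classical_set_scope.
Local Open Scope ring_scope.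
Local Open Scope complex_scope.
Variables (R : realType) (G : groupType) (m n : nat).

Definition atoms (A : 'M[group_ring G]_(m, n)) : seq (atom G 'I_m 'I_n) :=
  flatten [seq flatten [seq flatten
    [seq nseq `|A i j h|%N (Atom i j (A i j h < 0) h) | h <- finsupp (A i j)]
    | j <- index_enum 'I_n] | i <- index_enum 'I_m].

Lemma big_nseq_addr (V : nmodType) (T : Type) (k : nat) (x : T) (F : T -> V) :
  \sum_(y <- nseq k x) F y = F x *+ k.
Proof. by rewrite big_nseq iter_addr_0. Qed.

Lemma mulr_sign_abs (V : pzRingType) (c : int) (a : V) :
  ((-1) ^+ (c < 0)%R * a) *+ `|c|%N = a * c%:~R.
Proof.
case: c => c /=; first by rewrite mul1r mulr_natr.
by rewrite expr1 mulN1r mulNrn NegzE mulrNz mulrN mulr_natr.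
Qed.

Lemma rmul_mxE (A : 'M[group_ring G]_(m, n)) (x : vect R G m) j g :
  rmul_mx A x j g = op (atoms A) x j g.
Proof.
rewrite /rmul_mx /op /atoms big_flatten big_map; apply: eq_bigr => i _.
rewrite big_flatten big_map (bigD1 j) //= [X in _ = _ + X]big1 ?addr0.
  rewrite big_flatten big_map /rmul; apply: eq_bigr => h _.
  by rewrite big_nseq_addr /op1 /= eqxx mulr_sign_abs.
move=> j' /negbTE jj'; rewrite big_flatten big_map big1 // => h _.
by rewrite big_nseq_addr /op1 /= jj' mul0rn.
Qed.

Definition emb (u : 'I_m -> G -> R) : vect R G m := fun i g => (u i g)%:C.
Definition re (x : vect R G m) : 'I_m -> G -> R := fun i g => complex.Re (x i g).
Definition im (x : vect R G m) : 'I_m -> G -> R := fun i g => complex.Im (x i g).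

Lemma Re_mul_real (a : R) (z : R[i]) : complex.Re (a%:C * z) = a * complex.Re z.
Proof. by case: z => b c /=; rewrite mul0r subr0. Qed.
Lemma Im_mul_real (a : R) (z : R[i]) : complex.Im (a%:C * z) = a * complex.Im z.
Proof. by case: z => b c /=; rewrite mul0r addr0. Qed.

Lemma sign_real (b : bool) : (-1) ^+ b = ((-1) ^+ b : R)%:C.
Proof. by case: b; rewrite ?expr0 ?expr1 // rmorphN1. Qed.

Lemma re_op (J : finType) (L : seq (atom G 'I_m J)) x j g :
  complex.Re (op L x j g) = op L (re x) j g.
Proof.
rewrite /op raddf_sum; apply: eq_bigr => l _ /=; rewrite /op1; case: eqP => // _.
by rewrite sign_real Re_mul_real.
Qed.
Lemma im_op (J : finType) (L : seq (atom G 'I_m J)) x j g :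
  complex.Im (op L x j g) = op L (im x) j g.
Proof.
rewrite /op raddf_sum; apply: eq_bigr => l _ /=; rewrite /op1; case: eqP => // _.
by rewrite sign_real Im_mul_real.
Qed.

Lemma normc_sqr (z : R[i]) : Normc.normc z ^+ 2 = complex.Re z ^+ 2 + complex.Im z ^+ 2.
Proof. by case: z => a b /=; rewrite sqr_sqrtr // addr_ge0 // sqr_ge0. Qed.

Lemma l2_re_im x : l2 x <-> sql2 (re x) /\ sql2 (im x).
Proof.
have E (f : G -> R[i]) : square_summable f = summ (fun g => complex.Re (f g) ^+ 2 + complex.Im (f g) ^+ 2).
  rewrite /square_summable /summ; congr (is_true (summable _ _)).
  by apply/funext => g; congr EFin; exact: normc_sqr.
split=> [lx|[rx ix] i]; last by rewrite E; apply: summD; [exact: rx|exact: ix].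
by split=> i; move: (lx i); rewrite E; apply: summ_le => g;
  rewrite ger0_norm ?sqr_ge0 // ?lerDl ?lerDr sqr_ge0.
Qed.

Lemma inner_emb_r x z : inner x (emb z) = dot (re x) z +i* dot (im x) z.
Proof.
rewrite /inner; apply/eqP; rewrite eq_complex /= !raddf_sum /=.
apply/andP; split; apply/eqP; apply: eq_bigr => i _; congr real_sum;
  by apply/funext => g; rewrite /re /im /emb; case: (x i g) => a b /=; ring.
Qed.

Lemma inner_emb_l w x : sql2 w -> l2 x -> inner (emb w) x = dot w (re x) -i* dot w (im x).
Proof.
move=> sw /l2_re_im[rx ix].
rewrite /inner /dot; apply/eqP; rewrite eq_complex /= !raddf_sum /=.
apply/andP; split; apply/eqP; apply: eq_bigr => i _.
  congr real_sum; apply/funext => g; rewrite /re /im /emb; case: (x i g) => a b /=; ring.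
rewrite -real_sumN; last exact: summ_mul.
by congr real_sum; apply/funext => g; rewrite /re /im /emb; case: (x i g) => a b /=; ring.
Qed.

Variable A : 'M[group_ring G]_(m, n).
Local Notation L := (atoms A).
Local Notation V := (ker_rmul_mx (R := R) A).

Definition real_ker (u : 'I_m -> G -> R) := sql2 u /\ forall j g, op L u j g = 0.

Lemma ker_re_im x : V x <-> real_ker (re x) /\ real_ker (im x).
Proof.
split=> [[/l2_re_im[rx ix] x0]|[[rx r0] [ix i0]]].
  by split; split=> // j g; rewrite -?re_op -?im_op -rmul_mxE x0.
split; first by apply/l2_re_im.
by move=> j g; rewrite rmul_mxE; apply/eqP; rewrite eq_complex re_op im_op r0 i0 !eqxx.
Qed.

Lemma real_ker_lin a b u v : real_ker u -> real_ker v ->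
  real_ker (fun i g => a * u i g + b * v i g).
Proof.
move=> [su u0] [sv v0]; split; first exact: sql2_lin.
move=> j g; transitivity (a * op L u j g + b * op L v j g); last first.
  by rewrite u0 v0 !mulr0 addr0.
rewrite /op !mulr_sumr -big_split; apply: eq_bigr => l _ /=.
by rewrite /op1; case: eqP => _; [ring|rewrite !mulr0 addr0].
Qed.

Lemma real_ker0 : real_ker (fun _ _ => 0).
Proof.
split; first exact: sql2_0.
by move=> j g; rewrite /op big1 // => l _; rewrite /op1 mulr0 if_same.
Qed.

Lemma emb_ker u : real_ker u -> V (emb u).
Proof. by move=> ku; apply/ker_re_im; split=> //; exact: real_ker0. Qed.

Lemma sql2_dot_eq0 (I : finType) (u : I -> G -> R) : sql2 u -> dot u u = 0 ->
  u = fun _ _ => 0.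
Proof.
move=> su u0; apply/funext => i; apply/funext => g; apply/eqP.
by rewrite -sqrf_eq0 eq_le sqr_ge0 -u0 dot_ge_coord.
Qed.

Lemma basis_vectE i0 : @basis_vect R G m i0 = emb (@delta R G _ i0).
Proof.
apply/funext => i; apply/funext => g; rewrite /basis_vect /emb /delta.
by case: (i == i0); case: (g == 1%g).
Qed.

(** The basis vectors and the operator are real, so that the real limit of heat
    powers is a projection of the basis vector also among complex vectors.  The
    projection is unique: comparing with real kernel vectors shows that the
    imaginary part of any other candidate is orthogonal to itself, and so is the
    difference of the real parts. *)
Lemma orth_proj_ker i0 : orth_proj V (@basis_vect R G m i0) = emb (heat_lim R L i0).
Proof.
set y := heat_lim R L i0; set e := @delta R G _ i0.
have ky : real_ker y by split; [exact: sql2_heat_lim|exact: heat_lim_ker].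
have se : sql2 e := @sql2_delta R G _ i0.
have orth z : real_ker z -> dot (fun i g => 1 * e i g + (-1) * y i g) z = 0.
  move=> [sz z0]; rewrite dot_linl //; last by case: ky.
  by rewrite (heat_lim_orth i0 sz z0) -/y; ring.
have [] : [set x | V x /\ forall z, V z -> inner (fun i g => @basis_vect R G m i0 i g - x i g) z = 0]
    (orth_proj V (@basis_vect R G m i0)).
  apply: xgetPex; exists (emb y); split; first exact: emb_ker.
  move=> z Vz.
  have -> : (fun i g => @basis_vect R G m i0 i g - emb y i g) =
      emb (fun i g => 1 * e i g + (-1) * y i g).
    apply/funext => i; apply/funext => g; rewrite basis_vectE /emb -/e.
    by rewrite mul1r mulN1r rmorphB.
  have /ker_re_im[kr ki] := Vz; rewrite inner_emb_l; [|by apply: sql2_lin => //; case: ky|by case: Vz].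
  by rewrite !orth // oppr0.
set x := orth_proj _ _ => Vx ox; have /ker_re_im[kr ki] := Vx.
have ox' z : real_ker z ->
    dot (fun i g => 1 * e i g + (-1) * re x i g) z = 0 /\ dot (im x) z = 0.
  move=> kz; have := ox _ (emb_ker kz); rewrite inner_emb_r.
  move=> /eqP; rewrite eq_complex /= => /andP[/eqP r0 /eqP i0'].
  split.
    suff -> : (fun i g => 1 * e i g + (-1) * re x i g) =
        re (fun i g => @basis_vect R G m i0 i g - x i g) by exact: r0.
    apply/funext => i; apply/funext => g.
    by rewrite /re basis_vectE /emb -/e; case: (x i g) => a b /=; ring.
  have [sim _] := ki; have [sz _] := kz.
  have s0 : sql2 (fun (_ : 'I_m) (_ : G) => 0 : R) by exact: sql2_0.
  move: i0'; rewrite (_ : im _ = fun i g => (-1) * im x i g + 0 * 0).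
    by rewrite dot_linl // mul0r addr0 mulN1r => /eqP; rewrite oppr_eq0 => /eqP.
  apply/funext => i; apply/funext => g; rewrite /im basis_vectE /emb.
  by case: (x i g) => a b /=; ring.
have im0 : im x = fun _ _ => 0.
  by apply: sql2_dot_eq0; [case: ki|case: (ox' _ ki)].
have re_y : (fun i g => 1 * re x i g + (-1) * y i g) = fun _ _ => 0.
  have kd := real_ker_lin 1 (-1) kr ky; set d := (fun i g => _) in kd *.
  have [sd _] := kd; have [srx _] := kr; have [sy _] := ky.
  apply: sql2_dot_eq0 => //.
  have := orth _ kd; have [+ _] := ox' _ kd; rewrite dot_linl // dot_linl //.
  by rewrite {3}/d dot_linl //; lra.
apply/funext => i; apply/funext => g.
have := congr1 (fun f => f i g) re_y; have := congr1 (fun f => f i g) im0.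
rewrite /re /im /emb /= -/y; case: (x i g) => a b /= -> ay.
by congr (_ +i* _); lra.
Qed.

Lemma vN_dim_ker : vN_dim V = (\sum_i lambda R L i)%:C.
Proof.
rewrite /vN_dim rmorph_sum; apply: eq_bigr => i _.
rewrite orth_proj_ker basis_vectE inner_emb_r.
rewrite (_ : im _ = fun _ _ => 0) ?dot0l; last by do 2!apply/funext => ?.
congr (_ +i* _); rewrite dotC.
by rewrite (dot_delta i).
Qed.

End Complex.

(** * Traces of heat powers as signed counts of walks *)
Section HeatAtoms.
Variables (G : groupType) (I J : finType) (L : seq (atom G I J)).

(** The product of a term [l] with the adjoint of a term [l'], with the sign
    changed because the Laplacian is subtracted. *)
Definition comp_atom (l l' : atom G I J) : atom G I I :=
  Atom (asrc l) (asrc l') (~~ (aneg l (+) aneg l')) (ashift l * (ashift l')^-1)%g.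

(** The integral operator [K - laplace], as a list of signed translations. *)
Definition heat_atoms : seq (atom G I I) :=
  flatten [seq nseq (op_bound (size L)) (Atom i i false 1%g) | i <- index_enum I] ++
  flatten [seq [seq comp_atom l l' | l <- L & atgt l == atgt l'] | l' <- L].

Variable R : realType.
Local Notation K := ((op_bound (size L))%:R : R).

Lemma comp_atomE (V : pzRingType) (l l' : atom G I J) (u : I -> G -> V) i g :
  (if atgt l == atgt l' then op1 (comp_atom l l') u i g else 0) =
  - op1 (adj1 l') (op1 l u) i g.
Proof.
rewrite /op1 /=; have [_|ll'] := eqVneq (atgt l) (atgt l'); last first.
  by rewrite mulr0 if_same oppr0.
case: (asrc l' == i); last by rewrite oppr0.
rewrite !invgK invgM invgK mulgA mulrA -signr_addb.
by case: (aneg l) (aneg l') => -[] /=; rewrite ?expr0 ?expr1 ?mul1r ?mulN1r ?opprK.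
Qed.

Lemma op_heat_atoms (u : I -> G -> R) i g : op heat_atoms u i g = K * heat L u i g.
Proof.
rewrite /op big_cat /= big_flatten big_map (bigD1 i) //= [X in _ + X + _]big1; last first.
  by move=> i' /negbTE ii'; rewrite big_nseq_addr /op1 /= ii' mul0rn.
rewrite big_nseq_addr /op1 /= eqxx mul1r invg1 mulg1 addr0 /heat mulrDr mul1r mulr_natl.
congr (_ + _); rewrite mulrA mulrN mulfV ?mulN1r; last first.
  by rewrite lt0r_neq0 // op_bound_gt0.
rewrite /laplace [op (adj L) _ _ _]/op big_map big_flatten big_map -sumrN; apply: eq_bigr => l' _.
rewrite big_map big_filter big_mkcond /=.
transitivity (\sum_(l <- L) - op1 (adj1 l') (op1 l u) i g).
  by apply: eq_bigr => l _; rewrite -comp_atomE.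
rewrite sumrN; congr (- _); rewrite /op1 /=; case: eqP => _; last by rewrite big1.
by rewrite -mulr_sumr.
Qed.

Lemma op_scale (V : comPzRingType) (M : seq (atom G I I)) (c : V) u i g :
  op M (fun i g => c * u i g) i g = c * op M u i g.
Proof.
rewrite /op mulr_sumr; apply: eq_bigr => l _; rewrite /op1; case: eqP => _.
  by rewrite mulrCA.
by rewrite mulr0.
Qed.

Lemma op_intr (M : seq (atom G I I)) (u : I -> G -> int) i g :
  (op M u i g)%:~R = op M (fun i g => (u i g)%:~R : R) i g.
Proof.
rewrite /op rmorph_sum; apply: eq_bigr => l _; rewrite /op1; case: eqP => _ //=.
by rewrite rmorphM rmorph_sign.
Qed.

Definition deltaZ (i0 : I) : I -> G -> int := fun i g =>
  ((i == i0) && (g == 1%g))%:R.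

Lemma iter_heat_atoms i0 p i g :
  (iter p (op heat_atoms) (deltaZ i0) i g)%:~R = K ^+ p * heat_at R L i0 p i g.
Proof.
elim: p i g => [|p IH] i g.
  by rewrite expr0 mul1r /= /delta /deltaZ; case: (i == i0); case: (g == _).
rewrite iterS op_intr.
rewrite (_ : (fun i g => _) = fun i g => K ^+ p * heat_at R L i0 p i g); last first.
  by apply/funext => i'; apply/funext => g'; exact: IH.
by rewrite op_scale op_heat_atoms mulrA -exprSr /heat_at iterS.
Qed.

End HeatAtoms.

Section Walks.
Variable B : nat.

Definition digit (s r : nat) : nat := (s %/ B ^ r) %% B.

(** The base [B] digits of [s] below position [t] are the terms used by a walk
    of [t] steps; summation over walks is summation over [s < B ^ t].  Index,
    group element and sign of a walk are accumulated independently of each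
    other, which keeps every accumulator a number. *)
Definition walk (T : Type) (F : nat -> T -> T) (t s : nat) (x : T) : T :=
  iteri t (fun r => F (digit s r)) x.

Lemma iteri_head (T : Type) t (f : nat -> T -> T) x :
  iteri t.+1 f x = iteri t (fun r => f r.+1) (f 0%N x).
Proof. by elim: t x => //= t IH x; rewrite -IH. Qed.

Lemma walkS (T : Type) (F : nat -> T -> T) t s x :
  walk F t.+1 s x = walk F t (s %/ B) (F (s %% B)%N x).
Proof.
rewrite /walk iteri_head /digit expn0 divn1.
elim: t => //= t ->; by rewrite expnS divnMA.
Qed.

Lemma sum_divmod (V : nmodType) (n : nat) (f : nat -> V) :
  \sum_(0 <= s < (n * B)%N) f s = \sum_(0 <= s < n) \sum_(0 <= d < B) f (s * B + d)%N.
Proof.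
elim: n => [|n IH]; first by rewrite mul0n !big_geq.
rewrite mulSnr (big_cat_nat (n := n * B)) ?leq_addr //= IH big_nat_recr //=; congr (_ + _).
by rewrite -{1}[(n * B)%N]add0n big_addn addKn; apply: eq_bigr => d _; rewrite addnC.
Qed.
End Walks.

Section Counting.
Variables (G : groupType) (k : nat) (S : 'I_k -> G) (m : nat).
Variables (M : seq (atom G 'I_m 'I_m)) (wd : G -> word k).
Hypothesis wdK : forall g, eval_word S (wd g) = g.
Variable h : nat -> nat.
Hypothesis hP : forall w : word k, (h (choice.pickle w) == 1%N) = (eval_word S w == 1%g).

Lemma eval_word_cat (w w' : word k) :
  eval_word S (w ++ w') = (eval_word S w * eval_word S w')%g.
Proof. exact: big_cat. Qed.

Definition prepend (w : word k) (c : nat) : nat :=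
  foldr (fun l c => (2 ^ choice.pickle l * c.*2.+1)%N) c w.

Lemma prependE (w w' : word k) : prepend w (choice.pickle w') = choice.pickle (w ++ w').
Proof. by elim: w => //= l w ->. Qed.

(** Walks run from targets to sources, as the value of an operator at a target
    is made of values at sources.  A digit whose target is not the current index
    [j] kills the walk: [m] is not the number of an index and is never left. *)
Definition step_index (d j : nat) : nat :=
  if nth 0%N [seq nat_of_ord (atgt l) | l <- M] d == j
  then nth 0%N [seq nat_of_ord (asrc l) | l <- M] d else m.
Definition step_code (d c : nat) : nat := nth 0%N [seq prepend (wd (ashift l)) c | l <- M] d.
Definition step_sign (d a : nat) : nat := (a + nth 0%N [seq nat_of_bool (aneg l) | l <- M] d)%N.

Local Notation B := (size M).

Lemma walk_dead t s : walk B step_index t s m = m.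
Proof.
rewrite /walk; elim: t => //= t ->; rewrite /step_index; case: eqP => // tgtm.
set d := digit _ _ _ in tgtm *.
have [dB|Bd] := ltnP d B; last first.
  have m0 : m = 0%N by rewrite -tgtm nth_default // size_map.
  by rewrite nth_default ?size_map.
case: M dB tgtm => // l0 M' dB; rewrite (nth_map l0) // => tgtm.
by have := ltn_ord (atgt (nth l0 (l0 :: M') d)); rewrite tgtm ltnn.
Qed.

Definition accepts (t s : nat) (i0 i c : nat) : bool :=
  (walk B step_index t s i == i0) && (h (walk B step_code t s c) == 1%N).

(** The value of the iterate at [(i, g)] is a signed count of walks.  Applying
    a term replaces [g] by [g * (ashift l)^-1], so for the inverse of [g] a word
    is prepended; this is why the count is stated at the inverse of the group
    element spelled by [w]. *)
Lemma sum_walks (i0 : 'I_m) t (i : 'I_m) (w : word k) (a : nat) :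
  \sum_(0 <= s < (B ^ t)%N)
    (if accepts t s i0 i (choice.pickle w) then (-1) ^+ walk B step_sign t s a else 0 : int) =
  (-1) ^+ a * iter t (op M) (deltaZ i0) i (eval_word S w)^-1%g.
Proof.
elim: t i w a => [|t IH] i w a.
  rewrite expn0 big_nat1 /accepts /walk /= hP /deltaZ.
  rewrite -(inj_eq val_inj) invg_eq1 /=.
  by case: (_ && _); rewrite ?mulr1 ?mulr0.
rewrite expnSr sum_divmod exchange_big.
rewrite iterS [op M _ _ _]/op mulr_sumr.
transitivity (\sum_(0 <= d < B) \sum_(0 <= s < (B ^ t)%N)
    (if accepts t s i0 (step_index d i) (step_code d (choice.pickle w))
     then (-1) ^+ walk B step_sign t s (step_sign d a) else 0 : int)).
  rewrite !big_nat; apply: eq_bigr => d /andP[_ dB]; apply: eq_bigr => s _.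
  have B0 : (0 < B)%N by apply: leq_ltn_trans dB.
  by rewrite /accepts !walkS divnMDl // divn_small // addn0 modnMDl modn_small.
have [B0|B0] := posnP B.
  by rewrite B0 big_geq // (size0nil B0) big_nil.
have l0 : atom G 'I_m 'I_m by case: M B0.
rewrite [RHS](big_nth l0) !big_nat; apply: eq_bigr => d /andP[_ dB].
rewrite /step_index /step_code /step_sign !(nth_map l0) //.
set l := nth l0 M d; rewrite prependE /op1 -(inj_eq val_inj) /=.
case: eqP => [_|_]; last first.
  rewrite mulr0 big1 // => s _; rewrite /accepts walk_dead.
  by rewrite gtn_eqF.
rewrite IH exprD -mulrA; do 2!congr (_ * _); congr (iter t _ _ _ _).
by rewrite eval_word_cat wdK invgM.
Qed.

Definition count_walks (b : bool) (t : nat) : nat :=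
  (\sum_(i < m) \sum_(s < B ^ t)
     (accepts t s i i 0 && (odd (walk B step_sign t s 0) == b)))%N.

Lemma count_walksE t :
  (count_walks false t)%:Z - (count_walks true t)%:Z =
  \sum_(i < m) iter t (op M) (deltaZ i) i 1%g.
Proof.
rewrite -(natz (count_walks false t)) -(natz (count_walks true t)) /count_walks.
rewrite !natr_sum -sumrB; apply: eq_bigr => i _.
have := sum_walks i t i [::] 0; rewrite expr0 mul1r /eval_word big_nil invg1 => <-.
rewrite big_mkord !natr_sum -sumrB; apply: eq_bigr => s _.
by rewrite -signr_odd; case: (accepts _ _ _ _ _); case: (odd _).
Qed.

End Counting.

(** * The approximating sequence and its computation *)
Section Program.
Variables (G : groupType) (k m : nat) (M : seq (atom G 'I_m 'I_m)) (wd : G -> word k).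
Variable h : nat -> nat.
Local Notation B := (size M).

Definition edigit s r := emod (ediv s (eexp (econst B) r)) (econst B).

Definition ewalk (F : expr -> expr) T s x :=
  ERec T x (F (edigit (EWk 2 s) (EVar 0))).

Definition eindex d :=
  eif (eeq (eswitch [seq econst (nat_of_ord (atgt l)) | l <- M] d) (EVar 1))
      (eswitch [seq econst (nat_of_ord (asrc l)) | l <- M] d) (econst m).

Definition eprepend (w : word k) e :=
  foldr (fun l c => emul (econst (2 ^ choice.pickle l)) (ESucc (emul (econst 2) c))) e w.

Definition ecode d := eswitch [seq eprepend (wd (ashift l)) (EVar 1) | l <- M] d.

Definition esign d := eadd (EVar 1) (eswitch [seq econst (nat_of_bool (aneg l)) | l <- M] d).

Definition eaccept (b : bool) T i s :=
  emul (emul (eeq (ewalk eindex T s i) i) (eeq (EOrc (ewalk ecode T s EZero)) (econst 1)))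
       (eeq (emod (ewalk esign T s EZero) (econst 2)) (econst b)).

Definition ecount b T :=
  esum (econst m) (esum (eexp (econst B) (EWk 2 T)) (eaccept b (EWk 4 T) (EVar 2) (EVar 0))).

Definition elist (es : seq expr) :=
  foldr (fun a c => emul (eexp (econst 2) a) (ESucc (emul (econst 2) c))) EZero es.

(** The code of the rational number [num / den] for coprime positive arguments:
    nonnegative integers are coded as left summands. *)
Definition eposrat num den :=
  elist [:: elist [:: elist [:: num]; EZero]; elist [:: elist [:: den]; EZero]].

Definition etwice := eadd (EVar 0) (EVar 0).

Definition ebound (K : nat) :=
  let D := eexp (econst K) etwice in
  eposrat (ESucc (emul (esub (ecount false etwice) (ecount true etwice)) D)) (emul D D).

Lemma eval_walk rho F f T s x :
  (forall r acc rho d, eval h [:: r, acc & rho] (F d) = f (eval h [:: r, acc & rho] d) acc) ->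
  eval h rho (ewalk F T s x) = walk B f (eval h rho T) (eval h rho s) (eval h rho x).
Proof.
move=> Ff; rewrite /ewalk /walk; cbn [eval]; elim: (eval h rho T) => // t IH.
rewrite !iteriS IH Ff /edigit eval_mod eval_div eval_exp eval_const.
by cbn [eval]; rewrite [drop _ _]/= drop0.
Qed.

Lemma map_eval_const (T : Type) (f : T -> nat) rho (s : seq T) :
  map (eval h rho) [seq econst (f x) | x <- s] = [seq f x | x <- s].
Proof. by rewrite -map_comp; apply: eq_map => x /=; rewrite eval_const. Qed.

Lemma eval_index r acc rho d :
  eval h [:: r, acc & rho] (eindex d) = step_index M (eval h [:: r, acc & rho] d) acc.
Proof.
rewrite /eindex eval_if eval_eq !eval_switch !map_eval_const eval_const /step_index.
by case: eqP.
Qed.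

Lemma eval_prepend rho w e : eval h rho (eprepend w e) = prepend w (eval h rho e).
Proof.
elim: w => // l w IH.
rewrite [eprepend _ _]/(emul _ _) eval_mul eval_const eval_succ.
by rewrite eval_mul eval_const -/(eprepend w e) IH mul2n.
Qed.

Lemma eval_code r acc rho d :
  eval h [:: r, acc & rho] (ecode d) = step_code M wd (eval h [:: r, acc & rho] d) acc.
Proof.
rewrite /ecode eval_switch /step_code -map_comp; congr (nth _ _ _).
by apply: eq_map => l /=; rewrite eval_prepend.
Qed.

Lemma eval_sign r acc rho d :
  eval h [:: r, acc & rho] (esign d) = step_sign M (eval h [:: r, acc & rho] d) acc.
Proof. by rewrite /esign eval_add eval_switch map_eval_const. Qed.

Lemma eval_accept rho b T i s :
  eval h rho (eaccept b T i s) =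
  accepts M wd h (eval h rho T) (eval h rho s) (eval h rho i) (eval h rho i) 0 &&
  (odd (walk B (step_sign M) (eval h rho T) (eval h rho s) 0) == b).
Proof.
rewrite /eaccept !eval_mul !eval_eq eval_mod !eval_const; cbn [eval].
rewrite (eval_walk _ _ _ _ eval_index) (eval_walk _ _ _ _ eval_code).
rewrite (eval_walk _ _ _ _ eval_sign).
cbn [eval]; rewrite modn2 !mulnb /accepts; congr (nat_of_bool (_ && _)).
by case: (odd _); case: b.
Qed.

Lemma eval_count rho b T :
  eval h rho (ecount b T) = count_walks M wd h b (eval h rho T).
Proof.
rewrite /ecount (@eval_sum _ _ _ _ (fun i => \sum_(s < B ^ eval h rho T)
   (accepts M wd h (eval h rho T) s i i 0 &&
    (odd (walk B (step_sign M) (eval h rho T) s 0) == b)))%N) ?eval_const // => i acc.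
rewrite (@eval_sum _ _ _ _ (fun s =>
   (accepts M wd h (eval h rho T) s i i 0 &&
    (odd (walk B (step_sign M) (eval h rho T) s 0) == b)) : nat)).
  by rewrite eval_exp eval_const; cbn [eval]; rewrite [drop _ _]/= drop0.
by move=> s acc'; rewrite eval_accept; cbn [eval]; rewrite [drop _ _]/= drop0.
Qed.

Lemma eval_list rho es : eval h rho (elist es) = CodeSeq.code (map (eval h rho) es).
Proof.
elim: es => // e es IH.
rewrite [elist _]/(emul _ _) eval_mul eval_exp eval_const eval_succ.
by rewrite eval_mul eval_const -/(elist es) IH mul2n.
Qed.

Lemma eval_posrat rho num den a b :
  eval h rho num = a -> eval h rho den = b -> (0 < b)%N -> coprime a b ->
  eval h rho (eposrat num den) = choice.pickle (a%:~R / b%:~R : rat).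
Proof.
move=> <- <- d0 cop; rewrite pickle_ratE coprimeq_num // coprimeq_den //.
rewrite gtr0_sg ?ltz_nat // mul1r eqz_nat gtn_eqF //.
rewrite ger0_norm // /eposrat.
by do 3!(rewrite !eval_list; cbn [map]).
Qed.

End Program.

Section Approximation.
Local Open Scope classical_set_scope.
Local Open Scope ring_scope.
Variables (R : realType) (G : groupType) (k : nat) (S : 'I_k -> G).
Variables (m n : nat) (A : 'M[group_ring G]_(m, n)).

(** One call of the oracle decides whether a walk is closed. *)
Lemma encode_word_problem (w : word k) :
  (encode_set (word_problem S) (choice.pickle w) == 1%N) = (eval_word S w == 1%g).
Proof.
rewrite /encode_set /encode_fun pickleK_inv /char_fun /=.
have -> : `[< word_problem S w >] = (eval_word S w == 1%g).
  by apply/asboolP/eqP.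
by case: (eval_word S w == 1%g).
Qed.


Variable wd : G -> word k.
Hypothesis wdK : forall g, eval_word S (wd g) = g.

Local Notation L := (atoms A).
Local Notation K := (op_bound (size L)).
Local Notation h := (encode_set (word_problem S)).

Definition scale t : nat := K ^ t.*2.
Definition signed_count b t : nat := count_walks (heat_atoms L) wd h b t.*2.
(** The trace of a heat power is [N / D] with [D = scale t] and [N] the
    difference of the counts.  The fraction [(N * D + 1) / D ^ 2] exceeds it by
    [1 / D ^ 2] and is in lowest terms, so that its code can be written down
    explicitly. *)
Definition bound_num t : nat := ((signed_count false t - signed_count true t) * scale t).+1.
Definition bound_den t : nat := scale t * scale t.
Definition upper_bound t : rat := (bound_num t)%:~R / (bound_den t)%:~R.

Lemma scale_gt0 t : (0 < scale t)%N.
Proof. by rewrite expn_gt0 expn_gt0. Qed.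

Lemma signed_countE t :
  (signed_count false t)%:R - (signed_count true t)%:R =
  (scale t)%:R * \sum_(i < m) moment R L i t :> R.
Proof.
have := count_walksE (heat_atoms L) wdK encode_word_problem t.*2.
move=> /(congr1 (fun z : int => z%:~R : R)); rewrite rmorphB /= => ->.
rewrite rmorph_sum mulr_sumr natrX; apply: eq_bigr => i _.
exact: iter_heat_atoms.
Qed.

Lemma ratr_upper_bound t :
  ratr (upper_bound t) = \sum_(i < m) moment R L i t + (bound_den t)%:R^-1 :> R.
Proof.
have sg : 0 < (scale t)%:R :> R by rewrite ltr0n scale_gt0.
have cc : (signed_count true t <= signed_count false t)%N.
  rewrite -(ler_nat R) -subr_ge0 signed_countE; apply: mulr_ge0; first exact: ltW.
  by apply: sumr_ge0 => i _; exact: moment_ge0.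
rewrite /upper_bound fmorph_div /= !ratr_int -!pmulrn /bound_num /bound_den.
rewrite -natr1 !natrM natrB // signed_countE.
by field; rewrite lt0r_neq0.
Qed.

Lemma encode_upper_bound :
  encode_fun upper_bound = fun x => eval h [:: x] (ebound (heat_atoms L) wd K).
Proof.
apply/funext => t; rewrite /encode_fun (pickleK_inv t) /ebound.
have D : eval h [:: t] (eexp (econst K) etwice) = scale t.
  by rewrite eval_exp eval_const /etwice eval_add /= addnn.
have T : eval h [:: t] etwice = t.*2 by rewrite /etwice eval_add /= addnn.
have num : eval h [:: t] (ESucc (emul (esub (ecount (heat_atoms L) wd false etwice)
    (ecount (heat_atoms L) wd true etwice)) (eexp (econst K) etwice))) = bound_num t.
  by rewrite eval_succ eval_mul eval_sub !eval_count D T.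
have den : eval h [:: t] (emul (eexp (econst K) etwice) (eexp (econst K) etwice)) =
    bound_den t by rewrite eval_mul D.
rewrite (eval_posrat num den) //; first by rewrite muln_gt0 scale_gt0.
by rewrite /bound_num /bound_den coprimeMr andbb coprime_sym -addn1 /coprime gcdnMDl gcdn1.
Qed.

Lemma bound_den_cvg : ((bound_den t)%:R^-1 : R) @[t --> \oo] --> (0 : R).
Proof.
have k1 : `|(K%:R^-1 : R) ^+ 4| < 1.
  have K2 : (2 <= K)%N by rewrite /op_bound expnS leq_pmulr // expn_gt0.
  have K0 : 0 < K%:R :> R by rewrite ltr0n (leq_trans _ K2).
  rewrite normrX exprn_ilt1 // ger0_norm ?invr_ge0 ?ltW //.
  by rewrite invf_lt1 // ltr1n.
rewrite (_ : (fun t => _) = fun t => (K%:R^-1 ^+ 4) ^+ t); first exact: cvg_expr.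
apply/funext => t; rewrite /bound_den /scale natrM !natrX -exprD -exprVn -exprM.
by congr (_ ^+ _); lia.
Qed.

End Approximation.

Local Open Scope complex_scope.

Theorem theorem1p1 (R : realType) (a : turing_degree) (G : groupType)
    (k : nat) (S : 'I_k -> G) (S_generates : generates S)
    (word_problem_degree : degree_at_most (encode_set (word_problem S)) a)
    (m n : nat) (A : 'M[group_ring G]_(m, n)) :
  exists2 r : R, vN_dim (ker_rmul_mx (R := R) A) = r%:C & right_computable a r.
Proof.
have [g ag WPg] := word_problem_degree.
have [wd wdK] := choice S_generates.
exists (\sum_i lambda R (atoms A) i); first exact: vN_dim_ker.
exists (upper_bound S A wd); split.
- by exists g => //; rewrite encode_upper_bound; exact: eval_turing_le.
- rewrite (funext (ratr_upper_bound R A wdK)) -[X in (_ --> X)%classic]addr0.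
  apply: cvgD; last exact: bound_den_cvg.
  by apply: cvg_sumr => i; exact: moment_cvg.
- move=> t; rewrite ratr_upper_bound // ler_wpDr ?invr_ge0 //.
  by apply: ler_sum => i _; exact: moment_ge.
Qed.
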